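(* Let $p$ be a fixed prime. There exists a sequence $\{\mathcal{F}_i\}_{i=1}^{\infty}$ of finite families of smooth curves defined over $\mathbb{F}_p$ such that, writing $$M_i := \frac{1}{|\mathcal{F}_i|}\sum_{C\in\mathcal{F}_i}|C(\mathbb{F}_p)|,\qquad V_i := \frac{1}{|\mathcal{F}_i|}\sum_{C\in\mathcal{F}_i}\left(|C(\mathbb{F}_p)|-M_i\right)^2,$$ the quantities $|\mathcal{F}_i|$, $M_i$, $V_i$ all tend to infinity as $i\to\infty$, and, for every compact interval $I\subset\mathbb{R}$, $$\frac{1}{|\mathcal{F}_i|}\left|\left\{C\in\mathcal{F}_i : \frac{|C(\mathbb{F}_p)|-M_i}{V_i^{1/2}}\in I\right\}\right| = \frac{1}{\sqrt{2\pi}}\int_I e^{-x^2/2}\,dx+o(1)\qquad\text{as } i\to\infty.$$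
   Context: $\mathbb{F}_p$ is the finite field with $p$ elements. For a curve $C$ defined over $\mathbb{F}_p$, $C(\mathbb{F}_p)$ denotes its set of $\mathbb{F}_p$-points and $|C(\mathbb{F}_p)|$ the cardinality of this set. $M_i$ is thus the average number of $\mathbb{F}_p$-points on curves in $\mathcal{F}_i$ and $V_i$ is the variance of the point count over $\mathcal{F}_i$. The prime $p$ does not vary with $i$. *)

(* Defs.v *)
From HB Require Import structures.
From mathcomp Require Import all_boot all_order all_algebra all_field.
From mathcomp Require Import mpoly.

Set Implicit Arguments.
Unset Strict Implicit.
Unset Printing Implicit Defensive.

Import GRing.Theory Num.Theory.
Local Open Scope ring_scope.

(* Every point of P^n(K) has exactly one vector of homogeneous coordinates
   whose first nonzero coordinate is 1; P^n(K) is represented by these vectors. *)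
Definition normalized (K : fieldType) (n : nat) (v : 'rV[K]_n.+1) : bool :=
  [exists k, (v 0 k == 1) && [forall j : 'I_n.+1, (j < k)%N ==> (v 0 j == 0)]].

Record proj (K : fieldType) (n : nat) : Type :=
  Proj { coords : 'rV[K]_n.+1; _ : normalized coords }.

HB.instance Definition _ (K : fieldType) (n : nat) :=
  [isSub for @coords K n].
HB.instance Definition _ (K : fieldType) (n : nat) :=
  [Choice of proj K n by <:].
HB.instance Definition _ (K : finFieldType) (n : nat) :=
  [Finite of proj K n by <:].

Section Zariski.
Variables (K : fieldType) (n : nat).

(* Only used for homogeneous f, where it does not depend on the choice of
   homogeneous coordinates. *)
Definition vanishes (f : {mpoly K[n.+1]}) (P : proj K n) : bool :=
  f.@[fun j => coords P 0 j] == 0.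

Definition zero_locus (S : seq {mpoly K[n.+1]}) (P : proj K n) : bool :=
  all (fun f => vanishes f P) S.

Definition homogeneous (S : seq {mpoly K[n.+1]}) : bool :=
  all (fun f => f \is @ishomog n.+1 K mdeg) S.

Definition zincl (Z Z' : pred (proj K n)) : Prop := forall P, Z P -> Z' P.

Definition zclosed (Z : pred (proj K n)) : Prop :=
  exists2 S, homogeneous S & Z =1 zero_locus S.

Definition zirreducible (Z : pred (proj K n)) : Prop :=
  (exists P, Z P) /\
  forall Z1 Z2, zclosed Z1 -> zclosed Z2 ->
    zincl Z (predU Z1 Z2) -> zincl Z Z1 \/ zincl Z Z2.

Definition has_chain (Z : pred (proj K n)) (d : nat) : Prop :=
  exists c : nat -> pred (proj K n),
    (forall i, (i <= d)%N ->
       [/\ zclosed (c i), zirreducible (c i) & zincl (c i) Z]) /\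
    (forall i, (i < d)%N -> zincl (c i) (c i.+1) /\ ~ zincl (c i.+1) (c i)).

Definition krull_dim_is (Z : pred (proj K n)) (d : nat) : Prop :=
  has_chain Z d /\ ~ has_chain Z d.+1.

Definition jacobian (S : seq {mpoly K[n.+1]}) (P : proj K n) :
    'M[K]_(size S, n.+1) :=
  \matrix_(i, j) (mderiv j S`_i).@[fun k => coords P 0 k].

(* Jacobian criterion for the subscheme of P^n cut out by S to be smooth of
   dimension d at its point P.  By Euler's relation the rank of the homogeneous
   Jacobian is that of the Jacobian in any affine chart containing P, in every
   characteristic. *)
Definition smooth_at (S : seq {mpoly K[n.+1]}) (d : nat) (P : proj K n) : Prop :=
  (\rank (jacobian S P) + d)%N = n.

End Zariski.

Definition Fpbar (p : nat) : countClosedFieldType :=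
  projT1 (countable_algebraic_closure 'F_p).

Definition to_Fpbar (p : nat) : {rmorphism 'F_p -> Fpbar p} :=
  sval (projT2 (countable_algebraic_closure 'F_p)).

Definition base_change (p n : nat) (S : seq {mpoly 'F_p[n.+1]}) :
    seq {mpoly (Fpbar p)[n.+1]} :=
  map (map_mpoly (to_Fpbar p)) S.

Definition geom_points (p n : nat) (S : seq {mpoly 'F_p[n.+1]}) :
    pred (proj (Fpbar p) n) :=
  zero_locus (base_change S).

(* Smooth, projective, geometrically irreducible curves over F_p, embedded in
   P^n and given by homogeneous equations over F_p. *)
Record smooth_curve (p n : nat) : Type := SmoothCurve {
  equations : seq {mpoly 'F_p[n.+1]};
  equations_homogeneous : homogeneous equations;
  curve_geom_irreducible : zirreducible (geom_points equations);
  curve_dim1 : krull_dim_is (geom_points equations) 1;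
  curve_smooth : forall P, geom_points equations P ->
    smooth_at (base_change equations) 1 P
}.

Definition num_points (p n : nat) (C : smooth_curve p n) : nat :=
  #|[set P : proj 'F_p n | zero_locus (equations C) P]|.

(* A finite nonempty set of smooth curves in a common projective space,
   enumerated without repetition: two members having the same points over the
   algebraic closure are the same curve, even if given by different equations. *)
Record curve_family (p : nat) : Type := CurveFamily {
  ambient_dim : nat;
  family_card : nat;
  family_card_gt0 : (0 < family_card)%N;
  member : 'I_family_card -> smooth_curve p ambient_dim;
  member_inj : forall c c',
    geom_points (equations (member c)) =1 geom_points (equations (member c')) ->
    c = c'
}.

Arguments member {p} F c : rename.

Section Statistics.
Variables (R : rcfType) (p : nat) (F : curve_family p).

Definition family_mean : R :=
  (family_card F)%:R^-1 * \sum_c (num_points (member F c))%:R.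

Definition family_variance : R :=
  (family_card F)%:R^-1 *
  \sum_c ((num_points (member F c))%:R - family_mean) ^+ 2.

Definition normalized_count (c : 'I_(family_card F)) : R :=
  ((num_points (member F c))%:R - family_mean) / Num.sqrt family_variance.

Definition proportion_in (I : pred R) : R :=
  (family_card F)%:R^-1 *
  #|[set c | I (normalized_count c)]|%:R.

End Statistics.

(* Main.v *)
(* Let q be a large power of p, and h >= 1.  In P^(h+1) with coordinates
   x_0, x, y_1, ..., y_h, put y_0 := x_0 and consider the h equations
     y_(r+1)^q - y_(r+1) x_0^(q-1) = y_r x^(q-1) + x_0^2 G_r(x_0, x, y_1, ..., y_r)
   of degree q.  On x_0 = 1 the Jacobian is triangular with -1 on the diagonal.
   On x_0 = 0 the only point is (0 : 1 : 0 : ... : 0); there the gradient of the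
   r-th equation is that of -y_r, so this point is smooth too.  The affine part is
   a tower of Artin-Schreier coverings of the line, and the pole order at infinity
   of the right-hand sides is q^(r+1) - 1, prime to q: by induction on the tower,
   pole orders are additive, so that the functions on the affine curve form a
   domain, which gives irreducibility and dimension 1.

   Over F_p one has y^q = y.  The G_r are chosen so that on the F_p-points the
   right-hand sides vanish, except the last one, which is the indicator function
   of a given subset U of F_p^h.  Above each point outside U lie p points, and the
   curve has 1 + p (p^h - |U|) points.  Letting U run over the subsets of a fixed
   set with 2h elements, the point counts follow a symmetric binomial law, of
   variance p^2 h / 2, and the theorem is that of de Moivre and Laplace. *)
Require Import Defs.
From mathcomp Require Import all_boot all_order all_algebra.
From mathcomp Require Import zify ring lra.
From mathcomp Require mpoly all_field.
From Stdlib Require Import Classical.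

Set Implicit Arguments.
Unset Strict Implicit.
Unset Printing Implicit Defensive.

(** No function field or valuation is built: the functions on the affine curve are filtered by a
    bound on their pole order at infinity, and the filtration of a covering is defined from that of
    its base. Orders add up because of a congruence: if F has order n prime to q, a term a y^i with
    i < q has order congruent to i n modulo q, so distinct powers of y never compete for the leading
    term. The order q^(r+1) - 1 is (q^r - 1) + (q - 1) q^r, from y_r and x^(q-1); being again prime
    to q, it lets the tower grow. The factor x_0^2 serves twice: it bounds the degree of G_r by q -
    2, which keeps G_r below that order, and it removes G_r from the gradient at infinity. As the
    indicator function has degree h (p - 1), q must grow with h; this is harmless, since x^q = x on
    F_p for every power q of p. The 2h points are available because 2h <= p^h. For the limit law,
    weights are measured against the central binomial coefficient, binomial sums become integrals of
    step functions, and dominated convergence applies. *)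

Module Geometry.
Import all_field mpoly GRing.Theory.
Local Open Scope ring_scope.

(** * Artin-Schreier coverings and the degree at infinity *)

Section ArtinSchreierStep.
Variables (K : closedFieldType) (q : nat).
Hypotheses (q_gt1 : (1 < q)%N) (q_eq0 : q%:R = 0 :> K).
Local Notation T := (seq K).

(** The polynomial X^q - X - c has derivative -1, because q = 0 in [K], hence is separable: every
    fibre of the covering has exactly [q] points. *)
Lemma artin_schreier_roots (c : K) :
  exists rs : seq K, [/\ uniq rs, size rs = q &
    forall y, (y \in rs) = (y ^+ q - y == c)].
Proof.
pose P : {poly K} := 'X^q - ('X + c%:P).
have szXc : (size ('X + c%:P)%R <= 2)%N.
  by rewrite (leq_trans (size_polyD _ _)) // geq_max size_polyX (leq_trans (size_polyC_leq1 _)).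
have szP : size P = q.+1.
  by rewrite size_polyDl size_polyXn // size_polyN (leq_ltn_trans szXc).
have mP : P \is monic.
  rewrite monicE /lead_coef szP /= !coefE eqxx.
  by rewrite !gtn_eqF ?addr0 ?subr0 // ltnW.
have [rs defP] := closed_field_poly_normal P.
move: defP; rewrite (monicP mP) scale1r => defP.
exists rs; split.
- rewrite -separable_prod_XsubC -defP separable_poly.unlock.
  have -> : P^`() = - 1.
    by rewrite !derivE -mulr_natr -polyC_natr q_eq0 mulr0 addr0 sub0r.
  rewrite coprimep_sym -polyCN /= -[_%:P]mulr1 mul_polyC coprimepZl ?coprime1p //.
  by rewrite oppr_eq0 oner_eq0.
- by apply/eqP; rewrite -eqSS -szP defP size_prod_XsubC.
- move=> y; rewrite -root_prod_XsubC -defP rootE /P !hornerE.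
  by rewrite opprD addrA subr_eq0.
Qed.

(* [D d f] means that [f] is regular on [Z] with pole order less than [d] at
   infinity; in particular [D 0 f] means that [f] vanishes on [Z]. *)
Record degree_filtration (Z : pred T) (D : nat -> (T -> K) -> Prop) : Prop :=
  DegreeFiltration {
    filt_ext : forall d f g, {in Z, f =1 g} -> D d f -> D d g;
    filt0 : forall f, D 0%N f -> {in Z, forall s, f s = 0};
    filt_zero : forall d, D d (fun=> 0);
    filt_const : forall c, D 1%N (fun=> c);
    filt_le : forall d e f, (d <= e)%N -> D d f -> D e f;
    filt_add : forall d f g, D d f -> D d g -> D d (fun s => f s + g s);
    filt_mul : forall d e f g, D d f -> D e.+1 g ->
      D (d + e)%N (fun s => f s * g s);
    filt_dom : forall d e f g, D d.+1 f -> ~ D d f -> D e.+1 g -> ~ D e g ->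
      ~ D (d + e)%N (fun s => f s * g s) }.

Section FiltrationTheory.
Variables (Z : pred T) (D : nat -> (T -> K) -> Prop).
Hypothesis filtD : degree_filtration Z D.

Lemma filt_opp d f : D d f -> D d (fun s => - f s).
Proof.
move=> Df; have := filt_mul filtD Df (filt_const filtD (-1)).
by rewrite addn0; apply: (filt_ext filtD) => s _; rewrite mulrN1.
Qed.

Lemma filt_sub d f g : D d f -> D d g -> D d (fun s => f s - g s).
Proof. by move=> Df /filt_opp; apply: (filt_add filtD). Qed.

Lemma filt_sum (I : Type) (r : seq I) (P : pred I) d (f : I -> T -> K) :
  (forall i, P i -> D d (f i)) -> D d (fun s => \sum_(i <- r | P i) f i s).
Proof.
move=> Df; elim: r => [|i r IHr].
  by apply: (filt_ext filtD) (filt_zero filtD d) => s _; rewrite big_nil.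
have [Pi|nPi] := boolP (P i).
  by apply: (filt_ext filtD) (filt_add filtD (Df i Pi) IHr) => s _; rewrite big_cons Pi.
by apply: (filt_ext filtD) IHr => s _; rewrite big_cons (negPf nPi).
Qed.

Lemma filt_exp d f k : D d.+1 f -> D (k * d).+1 (fun s => f s ^+ k).
Proof.
move=> Df; elim: k => [|k IHk].
  by apply: (filt_ext filtD) (filt_const filtD 1) => s _; rewrite expr0.
rewrite mulSn addnC -addSn; apply: (filt_ext filtD) (filt_mul filtD IHk Df) => s _.
by rewrite exprSr.
Qed.

Lemma filt_prod (I : Type) (r : seq I) (P : pred I) (d : I -> nat) (f : I -> T -> K) :
  (forall i, P i -> D (d i).+1 (f i)) ->
  D (\sum_(i <- r | P i) d i).+1 (fun s => \prod_(i <- r | P i) f i s).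
Proof.
move=> Df; elim: r => [|i r IHr].
  by rewrite big_nil; apply: (filt_ext filtD) (filt_const filtD 1) => s _; rewrite big_nil.
rewrite big_cons; case: ifP => Pi; last first.
  by apply: (filt_ext filtD) IHr => s _; rewrite big_cons Pi.
rewrite addnC -addSn.
by apply: (filt_ext filtD) (filt_mul filtD IHr (Df i Pi)) => s _; rewrite big_cons Pi mulrC.
Qed.

Definition exact_degree d f := D d.+1 f /\ ~ D d f.

Lemma exact_mul d e f g : exact_degree d f -> exact_degree e g ->
  exact_degree (d + e) (fun s => f s * g s).
Proof.
move=> [Df nDf] [Dg nDg]; split; last exact: (filt_dom filtD).
by rewrite -addSn; apply: (filt_mul filtD).
Qed.

Lemma exact_exp d f k : (exists s, Z s) -> exact_degree d f ->
  exact_degree (k * d) (fun s => f s ^+ k).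
Proof.
move=> [s0 Zs0] [Df nDf]; elim: k => [|k IHk].
  split; first by apply: (filt_ext filtD) (filt_const filtD 1) => s _; rewrite expr0.
  by move=> /(filt0 filtD)/(_ s0 Zs0)/eqP; rewrite expr0 oner_eq0.
have [E1 E2] := exact_mul IHk (conj Df nDf).
rewrite mulSn addnC; split; first by apply: (filt_ext filtD) E1 => s _; rewrite exprSr.
by move=> E; apply: E2; apply: (filt_ext filtD) E => s _; rewrite exprSr.
Qed.

Lemma exact_add d f g : exact_degree d f -> D d g ->
  exact_degree d (fun s => f s + g s).
Proof.
move=> [Df nDf] Dg; split; first by apply: (filt_add filtD) => //; apply: (filt_le filtD) Dg.
move=> E; apply: nDf; apply: (filt_ext filtD) (filt_sub E Dg) => s _.
by rewrite addrK.
Qed.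

Lemma exact_exists d f : D d f -> ~ {in Z, forall s, f s = 0} ->
  exists e, exact_degree e f.
Proof.
elim: d => [|d IHd] Df nf0; first by case: nf0; apply: filt0 Df.
by have [/IHd|nDf] := classic (D d f); [apply | exists d].
Qed.

(** A function that is not zero on [Z] has an exact order and orders add, whereas the zero function
    lies in every step of the filtration: regular functions form a domain. *)
Lemma filt_integral d e f g : D d f -> D e g ->
  {in Z, forall s, f s * g s = 0} ->
  {in Z, forall s, f s = 0} \/ {in Z, forall s, g s = 0}.
Proof.
move=> Df Dg fg0; have [|nf0] := classic {in Z, forall s, f s = 0}; first by left.
right; apply: NNPP => ng0.
have [d' exf] := exact_exists Df nf0; have [e' exg] := exact_exists Dg ng0.
case: (exact_mul exf exg) => _; apply.
by apply: (filt_ext filtD) (filt_zero filtD _) => s Zs; rewrite fg0.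
Qed.

End FiltrationTheory.

(** * One covering y^q - y = F, with F of order n prime to q *)

Section Lift.
Variables (Z : pred T) (D : nat -> (T -> K) -> Prop) (F : T -> K) (n : nat).
Hypotheses (filtD : degree_filtration Z D) (degF : exact_degree D n F).
Hypothesis co_nq : coprime n q.

Definition lift_locus : pred T :=
  fun s => Z (behead s) && (head 0 s ^+ q - head 0 s == F (behead s)).

(* The number of [e] with [q * e + i * n < d]: a coefficient of [y ^+ i] of
   degree [e] contributes pole order [q * e + i * n]. *)
Definition coef_bound (d i : nat) := ((d - i * n + q.-1) %/ q)%N.

Lemma coef_boundP d i e : (e < coef_bound d i)%N = (q * e + i * n < d)%N.
Proof.
rewrite /coef_bound leq_divRL ?(ltnW q_gt1) // mulnC mulnS.
by move: q_gt1; set u := (q * e)%N; set v := (i * n)%N; lia.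
Qed.

(** As [n] is invertible modulo [q], the residue of an order modulo [q] determines the exponent of
    y. This is why leading terms cannot cancel. *)
Lemma coef_index_inj i j u v : (i < q)%N -> (j < q)%N ->
  (q * u + i * n)%N = (q * v + j * n)%N -> i = j.
Proof.
wlog leij : i j u v / (i <= j)%N => [IH|ltiq ltjq eqij].
  have [leij|/ltnW leji] := leqP i j; first exact: IH.
  by move=> ltiq ltjq /esym /(IH _ _ _ _ leji ltjq ltiq).
have : (q %| (j - i) * n)%N.
  rewrite mulnBl; suff -> : (j * n - i * n)%N = (q * (u - v))%N by rewrite dvdn_mulr.
  by have := leq_mul leij (leqnn n); rewrite mulnBr; lia.
rewrite Gauss_dvdl ?(coprime_sym q) // => /dvdnP[k /eqP].
by case: k => [|k] /eqP eqk; rewrite ?mulSn in eqk; lia.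
Qed.

(** Functions are expanded in the basis 1, y, ..., y^(q-1) over those of [Z]. As for a covering
    totally ramified at infinity, orders on [Z] are multiplied by [q]; then y has order [n], since
    y^q - y = F has order [q * n]. *)
Definition lift_filtration (d : nat) (f : T -> K) : Prop :=
  exists a : nat -> T -> K, (forall i, (i < q)%N -> D (coef_bound d i) (a i)) /\
  {in lift_locus, forall s, f s = \sum_(i < q) a i (behead s) * head 0 s ^+ i}.

(** Over a point of [Z], the difference of the two sums is a polynomial in y of size at most [q]
    that vanishes at the [q] distinct points of the fibre. *)
Lemma lift_unique (a b : nat -> T -> K) :
  {in lift_locus, forall s, \sum_(i < q) a i (behead s) * head 0 s ^+ i
                          = \sum_(i < q) b i (behead s) * head 0 s ^+ i} ->
  forall i, (i < q)%N -> {in Z, a i =1 b i}.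
Proof.
move=> eqab i ltiq s Zs.
have [rs [Urs szrs rsE]] := artin_schreier_roots (F s).
pose P := \poly_(i < q) (a i s - b i s).
have P0 : P = 0.
  apply: (@roots_geq_poly_eq0 _ P rs) => //; last by rewrite szrs size_poly.
  apply/allP => y; rewrite rsE => y_root; rewrite rootE horner_poly.
  have ysZ : lift_locus (y :: s) by rewrite /lift_locus /= [Z s]Zs.
  have := eqab _ ysZ; rewrite /= => /eqP; rewrite -subr_eq0 -sumrB => /eqP eq0.
  by under eq_bigr do rewrite mulrBl; rewrite eq0.
have := congr1 (fun Q : {poly K} => Q`_i) P0; rewrite coef_poly ltiq coef0.
by move=> /eqP; rewrite subr_eq0 => /eqP.
Qed.

Lemma lift_sum_single (a : T -> K) i s : (i < q)%N ->
  \sum_(j < q) (if j == i :> nat then a (behead s) else 0) * head 0 s ^+ j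
    = a (behead s) * head 0 s ^+ i.
Proof.
move=> ltiq; rewrite (bigD1 (Ordinal ltiq)) //= eqxx big1 ?addr0 // => j.
by rewrite -val_eqE /= => /negPf ->; rewrite mul0r.
Qed.

Lemma lift_monomial_inv d i a : (i < q)%N ->
  lift_filtration d (fun s => a (behead s) * head 0 s ^+ i) ->
  D (coef_bound d i) a.
Proof.
move=> ltiq [b [Db eqb]].
apply: (filt_ext filtD) (Db i ltiq) => s Zs; apply/esym.
pose c j t : K := if j == i then a t else 0.
suff /(_ i ltiq s Zs) : forall j, (j < q)%N -> {in Z, c j =1 b j} by rewrite /c eqxx.
by apply: lift_unique => t Zt; rewrite -eqb // -(lift_sum_single a t ltiq).
Qed.

Lemma lift_ext d f g :
  {in lift_locus, f =1 g} -> lift_filtration d f -> lift_filtration d g.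
Proof. by move=> fg [a [Da fa]]; exists a; split=> // s Zs; rewrite -fg ?fa. Qed.

Lemma lift_zero d : lift_filtration d (fun=> 0).
Proof.
exists (fun _ _ => 0); split=> [i _|s _]; first exact: filt_zero filtD _.
by rewrite big1 // => i _; rewrite mul0r.
Qed.

Lemma lift_le d e f : (d <= e)%N -> lift_filtration d f -> lift_filtration e f.
Proof.
move=> le_de [a [Da fa]]; exists a; split=> // i ltiq.
apply: (filt_le filtD) (Da i ltiq); rewrite leqNgt coef_boundP -leqNgt.
by rewrite (leq_trans le_de) // leqNgt -coef_boundP ltnn.
Qed.

Lemma lift_add d f g : lift_filtration d f -> lift_filtration d g ->
  lift_filtration d (fun s => f s + g s).
Proof.
move=> [a [Da fa]] [b [Db gb]]; exists (fun i s => a i s + b i s).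
split=> [i ltiq|s Zs]; first by apply: (filt_add filtD); [apply: Da|apply: Db].
by rewrite fa // gb // -big_split; apply: eq_bigr => i _; rewrite mulrDl.
Qed.

Lemma lift_bigsum (I : Type) (r : seq I) (P : pred I) d (f : I -> T -> K) :
  (forall i, P i -> lift_filtration d (f i)) ->
  lift_filtration d (fun s => \sum_(i <- r | P i) f i s).
Proof.
move=> Df; elim: r => [|i r IHr].
  by apply: (lift_ext _ (lift_zero d)) => s _; rewrite big_nil.
have [Pi|nPi] := boolP (P i).
  by apply: (lift_ext _ (lift_add (Df i Pi) IHr)) => s _; rewrite big_cons Pi.
by apply: (lift_ext _ IHr) => s _; rewrite big_cons (negPf nPi).
Qed.

Lemma lift_low_monomial d k i a : (i < q)%N -> D k a ->
  (forall e, (e < k)%N -> (q * e + i * n < d)%N) ->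
  lift_filtration d (fun s => a (behead s) * head 0 s ^+ i).
Proof.
move=> ltiq Da kd; exists (fun j t => if j == i then a t else 0); split; last first.
  by move=> s _; rewrite lift_sum_single.
move=> j ltjq; case: eqP => [->|_]; last exact: filt_zero filtD _.
by apply: (filt_le filtD) Da; case: k kd => // e /(_ e (leqnn _)); rewrite coef_boundP.
Qed.

Lemma lift_rewrite s i : s \in lift_locus -> (q <= i)%N ->
  head 0 s ^+ i = F (behead s) * head 0 s ^+ (i - q) + head 0 s ^+ (i - q).+1.
Proof.
case/andP=> _ /eqP eqF leqi; rewrite -eqF mulrBl -exprD subnKC // -exprS.
by rewrite subrK.
Qed.

(** Exponents up to 2q - 2 are those of a product of two basis elements, and for them a single use
    of y^q = F + y suffices. It does not raise the order: F y^(i-q) has the order of y^i, because F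
    contributes [q * n], and y^(i-q+1) has at most that order. *)
Lemma lift_monomial d k i a : (i < q.*2.-1)%N -> D k a ->
  (forall e, (e < k)%N -> (q * e + i * n < d)%N) ->
  lift_filtration d (fun s => a (behead s) * head 0 s ^+ i).
Proof.
move=> ltiq Da kd; have [|leqi] := ltnP i q; first by move=> ?; apply: lift_low_monomial Da kd.
case: k Da kd => [Da _|e Da /(_ e (leqnn _)) kd].
  apply: (lift_ext _ (lift_zero d)) => s /andP[Zs _].
  by rewrite (filt0 filtD Da) ?mul0r.
have ltiq1 : (i - q < q)%N by lia.
have ltiq2 : ((i - q).+1 < q)%N by lia.
have [DF _] := degF.
have E1 := @lift_low_monomial d _ (i - q) _ ltiq1 (filt_mul filtD Da DF).
have E2 := @lift_low_monomial d _ (i - q).+1 _ ltiq2 Da.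
apply: (lift_ext _ (lift_add (E1 _) (E2 _))).
- by move=> s Zs; rewrite (lift_rewrite Zs leqi) mulrDr !mulrA.
- rewrite addSn => e'; rewrite ltnS => lee'; apply: leq_ltn_trans kd.
  have := leq_mul (leqnn q) lee'; have := mulnDl (i - q)%N q n.
  by rewrite subnK // mulnDr; lia.
- move=> e'; rewrite ltnS => lee'; apply: leq_ltn_trans kd; apply: leq_add.
    by rewrite leq_mul2l lee' orbT.
  by rewrite leq_mul2r; apply/orP; right; lia.
Qed.

Lemma lift_mul d e f g : lift_filtration d f -> lift_filtration e.+1 g ->
  lift_filtration (d + e) (fun s => f s * g s).
Proof.
move=> [a [Da fa]] [b [Db gb]].
have E : lift_filtration (d + e) (fun s => \sum_(i < q) \sum_(j < q)
    (a i (behead s) * b j (behead s)) * head 0 s ^+ (i + j)).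
  apply: lift_bigsum => i _; apply: lift_bigsum => j _.
  have ltij : (i + j < q.*2.-1)%N by move: (ltn_ord i) (ltn_ord j); lia.
  have := Da i (ltn_ord i); have [c0|c_gt0] := posnP (coef_bound d i).
    rewrite c0 => Di; apply: (lift_ext _ (lift_zero _)) => s /andP[Zs _].
    by rewrite (filt0 filtD Di) // !mul0r.
  have := Db j (ltn_ord j); have [c0|c'_gt0] := posnP (coef_bound e.+1 j).
    rewrite c0 => Dj _; apply: (lift_ext _ (lift_zero _)) => s /andP[Zs _].
    by rewrite (filt0 filtD Dj) // mulr0 mul0r.
  rewrite -(prednK c_gt0) -(prednK c'_gt0).
  have := leqnn (coef_bound d i); rewrite -{1}(prednK c_gt0) coef_boundP.
  have := leqnn (coef_bound e.+1 j); rewrite -{1}(prednK c'_gt0) coef_boundP.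
  move: (coef_bound _ _).-1 (coef_bound _ _).-1 => v u ltv ltu Dj Di.
  apply: (lift_monomial (a := fun t => a i t * b j t) ltij (filt_mul filtD Di Dj)).
  move=> w; rewrite addSn ltnS => lew; apply: (@leq_ltn_trans (q * (v + u) + (i + j) * n)).
    by rewrite leq_add2r leq_mul2l lew orbT.
  by rewrite mulnDr mulnDl; lia.
apply: (lift_ext _ E) => s Zs; rewrite fa // gb // big_distrl.
by apply: eq_bigr => i _; rewrite /= big_distrr; apply: eq_bigr => j _; rewrite /= exprD; ring.
Qed.

(** Some coefficient must reach order [d], and by [coef_index_inj] only one can; removing its term
    leaves a function of smaller order. *)
Lemma lift_leading d f : lift_filtration d.+1 f -> ~ lift_filtration d f ->
  exists (i e : nat) (a f0 : T -> K),
    [/\ (i < q)%N, (q * e + i * n)%N = d, exact_degree D e a,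
        lift_filtration d f0 &
        {in lift_locus, forall s, f s = a (behead s) * head 0 s ^+ i + f0 s}].
Proof.
move=> [a [Da fa]] nDf.
have [i [ltiq nDi]] : exists i, (i < q)%N /\ ~ D (coef_bound d i) (a i).
  apply: NNPP => nex; apply: nDf; exists a; split=> // i ltiq.
  by apply: NNPP => nDi; apply: nex; exists i.
pose e := coef_bound d i.
have eqd : (q * e + i * n)%N = d.
  have : ~~ (coef_bound d.+1 i <= e)%N.
    by apply/negP => le_e; apply: nDi; apply: (filt_le filtD) (Da i ltiq).
  rewrite -ltnNge coef_boundP ltnS => led; apply/eqP; rewrite eqn_leq led /=.
  by rewrite leqNgt -coef_boundP ltnn.
have bound_i : coef_bound d.+1 i = e.+1.
  apply/eqP; rewrite eqn_leq coef_boundP eqd ltnS leqnn andbT leqNgt coef_boundP mulnS -eqd.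
  by move: q_gt1; lia.
exists i, e, (a i), (fun s => f s - a i (behead s) * head 0 s ^+ i); split=> //.
- by split=> //; rewrite -bound_i; apply: Da.
- exists (fun j t => if j == i then 0 else a j t); split; last first.
    move=> s Zs; rewrite fa // (bigD1 (Ordinal ltiq)) //= [in RHS](bigD1 (Ordinal ltiq)) //=.
    rewrite eqxx mul0r add0r addrAC subrr add0r; apply: eq_bigr => j.
    by rewrite -val_eqE /= => /negPf ->.
  move=> j ltjq; case: eqP => [_|neji]; first exact: filt_zero filtD _.
  apply: (filt_le filtD) (Da j ltjq); rewrite leqNgt; apply/negP.
  rewrite coef_boundP ltnS => le1.
  have /eqP eq1 : (q * coef_bound d j + j * n)%N == d.
    by rewrite eqn_leq le1 leqNgt -coef_boundP ltnn.
  exact/neji/(coef_index_inj ltjq ltiq (etrans eq1 (esym eqd))).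
- by move=> s _; rewrite addrC subrK.
Qed.

(** Up to smaller orders the product is that of the leading terms, a b y^(i+j). Were it of smaller
    order too, uniqueness of the expansion would bound its coefficient, against the domain property
    on [Z]. *)
Lemma lift_dom d e f g :
  lift_filtration d.+1 f -> ~ lift_filtration d f ->
  lift_filtration e.+1 g -> ~ lift_filtration e g ->
  ~ lift_filtration (d + e) (fun s => f s * g s).
Proof.
move=> Df nDf Dg nDg Dfg.
have [i [u [a [f0 [ltiq eqd exa Df0 fE]]]]] := lift_leading Df nDf.
have [j [v [b [g0 [ltjq eqe exb Dg0 gE]]]]] := lift_leading Dg nDg.
have exab := exact_mul filtD exa exb.
have Dlow c : lift_filtration (d + e) c -> lift_filtration (d + e) (fun s => - c s).
  move=> [c' [Dc' cE]]; exists (fun i s => - c' i s); split=> [k ltk|s Zs].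
    by apply: (filt_opp filtD); apply: Dc'.
  by rewrite cE // -sumrN; apply: eq_bigr => k _; rewrite mulNr.
have Dtop : lift_filtration (d + e)
    (fun s => (a (behead s) * b (behead s)) * head 0 s ^+ (i + j)).
  have D1 := lift_mul Df0 Dg.
  have D2 : lift_filtration (d + e) (fun s => g0 s * (a (behead s) * head 0 s ^+ i)).
    rewrite addnC; apply: lift_mul => //.
    apply: (lift_low_monomial ltiq (proj1 exa)) => w; rewrite ltnS => lew.
    by rewrite ltnS -eqd leq_add2r leq_mul2l lew orbT.
  apply: (lift_ext _ (lift_add Dfg (lift_add (Dlow _ D1) (Dlow _ D2)))) => s Zs.
  by rewrite fE // gE // exprD; ring.
have degab : (q * (u + v) + (i + j) * n)%N = (d + e)%N.
  by rewrite mulnDr mulnDl -eqd -eqe; lia.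
have [ltij|leij] := ltnP (i + j) q.
  apply: (proj2 exab); apply: (filt_le filtD) (lift_monomial_inv (a := fun t => a t * b t) ltij Dtop).
  by rewrite leqNgt coef_boundP degab ltnn.
(* Here y^(i+j) has to be reduced: the coefficient to examine is a b F, at y^(i+j-q). The other
   term, a b y^(i+j-q+1), is of smaller order because [n > 0], a consequence of coprimality with
   [q > 1]. *)
have exabF := exact_mul filtD exab degF.
apply: (proj2 exabF).
have lt1 : (i + j - q < q)%N by lia.
apply: (filt_le filtD) (lift_monomial_inv (a := fun t => a t * b t * F t) (d := d + e) lt1 _).
  rewrite leqNgt coef_boundP -degab -{2}(subnK leij) mulnDr mulnDl.
  by rewrite addnAC addnA ltnn.
have Dlow' : lift_filtration (d + e) (fun s => a (behead s) * b (behead s) * head 0 s ^+ (i + j - q).+1).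
  apply: (lift_monomial (a := fun t => a t * b t) _ (proj1 exab)); first by lia.
  move=> w; rewrite ltnS => lew; rewrite -degab.
  have n_gt0 : (0 < n)%N by case: n co_nq => //; rewrite /coprime gcd0n; lia.
  rewrite -addnS leq_add ?leq_mul2l ?lew ?orbT // ltn_mul2r n_gt0; lia.
apply: (lift_ext _ (lift_add Dtop (Dlow _ Dlow'))) => s Zs.
by rewrite (lift_rewrite Zs leij); ring.
Qed.

Lemma lift_degree_filtration : degree_filtration lift_locus lift_filtration.
Proof.
split.
- exact: lift_ext.
- move=> f [a [Da fa]] s Zs; rewrite fa // big1 // => i _.
  have := Da i (ltn_ord i); have -> : coef_bound 0 i = 0%N.
    by apply/eqP; rewrite -leqn0 leqNgt coef_boundP.
  by case/andP: Zs => Zs _ /(filt0 filtD) -> //; rewrite mul0r.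
- exact: lift_zero.
- move=> c; have := @lift_low_monomial 1 1 0 (fun=> c) (ltnW q_gt1) (filt_const filtD c).
  move=> E; apply: lift_ext (E _) => [s _|e]; first by rewrite expr0 mulr1.
  by rewrite ltnS leqn0 => /eqP ->; rewrite muln0.
- exact: lift_le.
- exact: lift_add.
- exact: lift_mul.
- exact: lift_dom.
Qed.

Lemma exact_lift d a : exact_degree D d a ->
  exact_degree lift_filtration (q * d) (fun s => a (behead s)).
Proof.
move=> [Da nDa]; split.
  apply: (lift_ext _ (lift_low_monomial (i := 0) (ltnW q_gt1) Da _)) => [s _|e].
    by rewrite expr0 mulr1.
  by rewrite addn0 !ltnS leq_mul2l => ->; rewrite orbT.
move=> E; apply: nDa; apply: (filt_le filtD) (lift_monomial_inv (i := 0) (d := q * d) (ltnW q_gt1) _).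
  by rewrite leqNgt coef_boundP addn0 ltnn.
by apply: lift_ext E => s _; rewrite expr0 mulr1.
Qed.

Lemma exact_root : (exists s, Z s) ->
  exact_degree lift_filtration n (fun s => head 0 s).
Proof.
move=> [s0 Zs0]; split.
  apply: (lift_ext _ (lift_low_monomial (i := 1) (d := n.+1) q_gt1 (filt_const filtD 1) _)) => [s _|e].
    by rewrite mul1r.
  by rewrite ltnS leqn0 => /eqP ->; rewrite muln0 mul1n.
move=> E; have := lift_monomial_inv (i := 1) (a := fun=> 1) (d := n) q_gt1 (lift_ext _ E).
have -> : coef_bound n 1 = 0%N by apply/eqP; rewrite -leqn0 leqNgt coef_boundP muln0 mul1n ltnn.
by move=> /(_ (fun s _ => esym (mul1r _)))/(filt0 filtD)/(_ s0 Zs0)/eqP; rewrite oner_eq0.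
Qed.

End Lift.
End ArtinSchreierStep.

(** * Towers of Artin-Schreier coverings of the affine line *)

Section ArtinSchreierTower.
Variables (K : closedFieldType) (q : nat).
Hypotheses (q_gt1 : (1 < q)%N) (q_eq0 : q%:R = 0 :> K).
Local Notation T := (seq K).

(* A point of the affine curve is listed as [y_r; ...; y_1; x; 1]. *)
Definition co (s : T) (j : nat) : K := nth 0 (rev s) j.

Lemma co_cons y s j : co (y :: s) j =
  if (j < size s)%N then co s j else if j == size s then y else 0.
Proof. by rewrite /co rev_cons nth_rcons size_rev. Qed.

Section Zeros.
Variables (Z : pred T) (D : nat -> (T -> K) -> Prop).
Hypothesis filtD : degree_filtration Z D.

(** Regular functions lie in a finitely generated [K[x]]-module, x being coordinate 1: the curve is
    finite over the x-line. *)
Definition finitely_spanned := exists (I : finType) (e : I -> T -> K),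
  forall d f, D d f -> exists c : I -> {poly K},
    {in Z, forall s, f s = \sum_b (c b).[co s 1] * e b s}.

Lemma filt_horner d (P : {poly K}) : D d.+1 (fun s => co s 1) ->
  D (size P * d).+1 (fun s => P.[co s 1]).
Proof.
move=> Dx; apply: (filt_ext filtD (f := fun s => \sum_(i < size P) P`_i * co s 1 ^+ i)).
  by move=> s _; rewrite horner_coef.
apply: (filt_sum filtD) => i _; have := filt_mul filtD (filt_const filtD P`_i) (filt_exp filtD i Dx).
by apply: (filt_le filtD); rewrite addSn ltnS add0n leq_mul2r ltnW ?orbT.
Qed.

Definition bieval (u : {poly {poly K}}) (x y : K) := (map_poly (horner_eval x) u).[y].

Lemma filt_bieval d e f (u : {poly {poly K}}) :
  D d.+1 (fun s => co s 1) -> D e.+1 f ->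
  exists k, D k (fun s => bieval u (co s 1) (f s)).
Proof.
move=> Dx Df; elim/poly_ind: u => [|u c [k Dk]].
  by exists 0%N; apply: (filt_ext filtD) (filt_zero filtD 0) => s _; rewrite /bieval rmorph0 horner0.
have Dc := filt_horner c Dx; have := filt_mul filtD Dk Df.
set k1 := (k + e)%N => Dm; set k2 := (size c * d).+1 in Dc.
exists (maxn k1 k2); apply: (filt_ext filtD) (filt_add filtD
  (filt_le filtD (leq_maxl k1 k2) Dm) (filt_le filtD (leq_maxr k1 k2) Dc)) => s _.
by rewrite /bieval rmorphD rmorphM /= map_polyX map_polyC !hornerE.
Qed.

(* [f] is integral over [K[x]]; dividing a polynomial relation by the largest
   power of [f] leaves a nonzero constant term, which vanishes where [f] does. *)
Lemma zeros_bounded d e f : finitely_spanned -> D e.+1 (fun s => co s 1) ->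
  D d f -> ~ {in Z, forall s, f s = 0} ->
  exists2 N : {poly K}, N != 0 & {in Z, forall s, f s = 0 -> N.[co s 1] = 0}.
Proof.
move=> [I [b spanD]] Dx Df nf0.
have {}Df : D d.+1 f by apply: (filt_le filtD) Df.
have [u u_neq0 u_f] : exists2 u : {poly {poly K}}, u != 0 &
    {in Z, forall s, bieval u (co s 1) (f s) = 0}.
  (* The [m.+1] powers of [f] from 0 to [m] have coordinate vectors in [K[x]^m], so they satisfy a
     nontrivial relation over [K[x]]. *)
  pose m := #|I|.
  have /fin_all_exists[c cE] : forall i : 'I_m.+1, exists ci : I -> {poly K},
      {in Z, forall s, f s ^+ i = \sum_j (ci j).[co s 1] * b j s}.
    by move=> i; apply: spanD (filt_exp filtD i Df).
  (* A zero last column makes M square, hence singular. *)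
  pose M := \matrix_(i < m.+1, j < m.+1)
    oapp (fun j' : 'I_m => c i (enum_val j')) 0 (insub (j : nat)).
  have /det0P[v v_neq0 vM] : \det M == 0.
    rewrite (expand_det_col _ ord_max) big1 // => i _.
    by rewrite mxE insubF ?mul0r //= ltnn.
  exists (\poly_(i < m.+1) v 0 (inord i)).
    apply: contraNneq v_neq0 => eq0; apply/eqP/rowP => i; rewrite mxE.
    have := congr1 (fun P : {poly {poly K}} => P`_i) eq0.
    by rewrite coef_poly ltn_ord inord_val coef0.
  move=> s Zs; rewrite /bieval.
  have -> : map_poly (horner_eval (co s 1)) (\poly_(i < m.+1) v 0 (inord i))
      = \poly_(i < m.+1) (v 0 (inord i)).[co s 1].
    by apply/polyP => i; rewrite coef_map !coef_poly /=; case: ifP; rewrite /horner_eval ?horner0.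
  rewrite horner_poly.
  under eq_bigr => i _ do rewrite inord_val (cE _ _ Zs) mulr_sumr.
  rewrite exchange_big big1 //= => j _.
  pose j' := widen_ord (leqnSn m) (enum_rank j).
  have := congr1 (fun A : 'rV[{poly K}]_m.+1 => (A 0 j').[co s 1]) vM.
  rewrite !mxE horner0 horner_sum => vM0.
  transitivity ((\sum_(i < m.+1) (v 0 i * M i j').[co s 1]) * b j s); last by rewrite vM0 mul0r.
  rewrite mulr_suml; apply: eq_bigr => i _.
  rewrite mulrA hornerM mxE (_ : insub (j' : nat) = Some (enum_rank j)); last exact: valK.
  by rewrite /= enum_rankK.
have [u' [u0_neq0 u'_f]] : exists u : {poly {poly K}}, u`_0 != 0 /\
    {in Z, forall s, bieval u (co s 1) (f s) = 0}.
  elim/poly_ind: u u_neq0 u_f => [|u c IHu]; first by rewrite eqxx.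
  move=> uc_neq0 uc_f; have [c0|c_neq0] := eqVneq c 0; last first.
    by exists (u * 'X + c%:P); split=> //; rewrite coefD coefMX coefC add0r.
  rewrite c0 addr0 in uc_neq0 uc_f; apply: IHu.
    by apply: contraNneq uc_neq0 => ->; rewrite mul0r.
  have [k Dk] := filt_bieval u Dx Df.
  have fu0 : {in Z, forall s, f s * bieval u (co s 1) (f s) = 0}.
    by move=> s Zs; have := uc_f s Zs; rewrite /bieval rmorphM /= map_polyX hornerMX mulrC.
  by case: (filt_integral filtD Df Dk fu0).
exists u'`_0 => // s Zs fs0; have := u'_f s Zs.
by rewrite /bieval fs0 horner_coef0 coef_map.
Qed.

End Zeros.

Definition base_locus : pred T := fun s => s == [:: head 0 s; 1].

(** On the line the pole order is the degree; [size] is the degree plus one, so that [size P <= d]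
    means order less than [d], and [d = 0] leaves only the zero polynomial. *)
Definition base_filtration (d : nat) (f : T -> K) : Prop :=
  exists2 P : {poly K}, (size P <= d)%N &
    {in base_locus, forall s, f s = P.[co s 1]}.

Lemma base_locusP x : [:: x; 1] \in base_locus.
Proof. by rewrite unfold_in /base_locus /= eqxx. Qed.

Lemma base_unique (P Q : {poly K}) :
  {in base_locus, forall s, P.[co s 1] = Q.[co s 1]} -> P = Q.
Proof.
move=> eqPQ; apply/eqP; rewrite -subr_eq0; apply/negPn/negP => /closed_nonrootP[x].
by rewrite rootE !hornerE; have := eqPQ _ (base_locusP x); rewrite /co /= => ->; rewrite subrr eqxx.
Qed.

Lemma base_exact d f P : {in base_locus, forall s, f s = P.[co s 1]} ->
  (base_filtration d f <-> (size P <= d)%N).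
Proof.
move=> fP; split=> [[Q szQ fQ]|]; last by exists P.
by rewrite (@base_unique P Q) // => s Zs; rewrite -fP // fQ.
Qed.

Lemma base_degree_filtration : degree_filtration base_locus base_filtration.
Proof.
split.
- by move=> d f g fg [P szP fP]; exists P => // s Zs; rewrite -fg // fP.
- by move=> f [P]; rewrite leqn0 size_poly_eq0 => /eqP -> fP s /fP ->; rewrite horner0.
- by move=> d; exists 0; [rewrite size_poly0 | move=> s _; rewrite horner0].
- by move=> c; exists c%:P; [apply: size_polyC_leq1 | move=> s _; rewrite hornerC].
- by move=> d e f le_de [P szP fP]; exists P; first apply: leq_trans le_de.
- move=> d f g [P szP fP] [Q szQ gQ]; exists (P + Q) => [|s Zs].
    by rewrite (leq_trans (size_polyD _ _)) // geq_max szP.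
  by rewrite fP // gQ // hornerD.
- move=> d e f g [P szP fP] [Q szQ gQ]; exists (P * Q) => [|s Zs].
    by rewrite (leq_trans (size_polyMleq _ _)) // -subn1 leq_subLR add1n -addnS leq_add.
  by rewrite fP // gQ // hornerM.
- move=> d e f g Df nDf Dg nDg; case: Df Dg => P szP fP [Q szQ gQ].
  have fgPQ : {in base_locus, forall s, f s * g s = (P * Q).[co s 1]}.
    by move=> s Zs; rewrite fP // gQ // hornerM.
  move/(base_exact _ fP): nDf => nDf; move/(base_exact _ gQ): nDg => nDg.
  move/negP: nDf; move/negP: nDg; rewrite -!ltnNge => ltQ ltP.
  have P0 : P != 0 by rewrite -size_poly_gt0; apply: leq_ltn_trans ltP.
  have Q0 : Q != 0 by rewrite -size_poly_gt0; apply: leq_ltn_trans ltQ.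
  apply/(base_exact _ fgPQ)/negP; rewrite size_mul // -ltnNge.
  by rewrite -ltnS prednK ?addn_gt0 ?size_poly_gt0 ?P0 // -addnS -addSn leq_add.
Qed.

Lemma base_spanned : finitely_spanned base_locus base_filtration.
Proof.
exists unit, (fun _ _ => 1) => d f [P _ fP]; exists (fun=> P) => s Zs.
by rewrite (bigD1 tt) //= big1 ?addr0 ?mulr1 ?fP // => -[].
Qed.

(** The place of y_r among the coordinates x_0, x, y_1, y_2, ..., with y_0 = x_0; index 1, which is
    that of x, is skipped. *)
Definition prev_index (r : nat) : nat := if r is 0 then 0 else r.+1.

Section Tower.
Variable G : nat -> T -> K.

(* The [(r+1)]-st equation reads [y_{r+1} ^+ q - y_{r+1} = tower_fun r],
   with [y_0 = 1]. *)
Definition tower_fun r (s : T) := co s (prev_index r) * co s 1 ^+ q.-1 + G r s.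

Fixpoint tower_locus r : pred T :=
  if r is r'.+1 then lift_locus q (tower_locus r') (tower_fun r') else base_locus.

Fixpoint tower_filtration r : nat -> (T -> K) -> Prop :=
  if r is r'.+1 then
    lift_filtration q (tower_locus r') (tower_filtration r') (tower_fun r') (q ^ r).-1
  else base_filtration.

(** It takes the form of an implication because it is applied inside the induction on [r], where the
    filtration of level [r] has just been shown to be one. *)
Hypothesis lower_order : forall r,
  degree_filtration (tower_locus r) (tower_filtration r) ->
  (forall j, tower_filtration r (q ^ r).+1 (fun s => co s j)) ->
  tower_filtration r (q ^ r.+1).-1 (G r).

Lemma tower_locus_size r s : tower_locus r s -> size s = r.+2.
Proof.
elim: r s => [|r IHr] s /=; first by move/eqP->.
by case/andP=> /IHr; case: s => //= y s ->.
Qed.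

Lemma tower_locus_co0 r s : tower_locus r s -> co s 0 = 1.
Proof.
elim: r s => [|r IHr] s /=; first by move/eqP->; rewrite /co.
case: s => [|y s]; first by case/andP=> /tower_locus_size.
by case/andP=> Zs _; rewrite co_cons (tower_locus_size Zs) /= IHr.
Qed.

Lemma tower_locusS r y s : tower_locus r.+1 (y :: s) =
  tower_locus r s && (y ^+ q - y == tower_fun r s).
Proof. by []. Qed.

Lemma tower_locus_extend r s : tower_locus r s -> exists y, tower_locus r.+1 (y :: s).
Proof.
move=> Zs; have [rs [_ szrs rsE]] := artin_schreier_roots q_gt1 q_eq0 (tower_fun r s).
case: rs szrs rsE => [|y rs _ rsE]; first by move=> e; move: q_gt1; rewrite -e.
by exists y; rewrite tower_locusS Zs -rsE mem_head.
Qed.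

Lemma tower_locus_x r x : exists2 s, tower_locus r s & co s 1 = x.
Proof.
elim: r => [|r [s Zs xs]]; first by exists [:: x; 1] => //; apply: base_locusP.
have [y Zys] := tower_locus_extend Zs; exists (y :: s) => //.
by rewrite co_cons (tower_locus_size Zs).
Qed.

Lemma tower_locus_behead r s j : tower_locus r.+1 s -> (j < r.+2)%N ->
  co s j = co (behead s) j.
Proof.
by case: s => [|y s] /andP[/tower_locus_size sz _] // ltj; rewrite co_cons sz ltj.
Qed.

Lemma tower_locus_head r s : tower_locus r.+1 s -> co s r.+2 = head 0 s.
Proof.
by case: s => [|y s] /andP[/tower_locus_size sz _] //; rewrite co_cons sz ltnn eqxx.
Qed.

(** The exact orders of x and y_r yield that of the next right-hand side; the bound on all
    coordinates other than x says that x alone dominates at infinity. *)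
Definition tower_invariant r :=
  let D := tower_filtration r in
  [/\ degree_filtration (tower_locus r) D,
      exact_degree D (q ^ r)%N (fun s => co s 1),
      exact_degree D (q ^ r).-1 (fun s => co s (prev_index r)) &
      forall j, (j != 1)%N -> D (q ^ r)%N (fun s => co s j)].

Lemma tower_nonempty r : exists s, tower_locus r s.
Proof. by have [s Zs _] := tower_locus_x r 0; exists s. Qed.

Lemma tower_coord r j : tower_invariant r -> tower_filtration r (q ^ r).+1 (fun s => co s j).
Proof.
move=> [filtD [Dx _] _ Dco]; have [->//|/Dco] := eqVneq j 1%N.
exact: (filt_le filtD).
Qed.

(** The main term y_r x^(q-1) has order (q^r - 1) + (q - 1) q^r, and adding [G r], which has smaller
    order, does not change it. *)
Lemma tower_fun_exact r : tower_invariant r ->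
  exact_degree (tower_filtration r) (q ^ r.+1).-1 (tower_fun r).
Proof.
move=> inv; have [filtD exx exy Dco] := inv.
have q_r : (0 < q ^ r)%N by rewrite expn_gt0 ltnW.
have eqn : (q ^ r.+1).-1 = ((q ^ r).-1 + q.-1 * q ^ r)%N.
  by have := mulSn q.-1 (q ^ r)%N; rewrite (prednK (ltnW q_gt1)) -expnS => ->; lia.
apply: (exact_add filtD); last exact: lower_order filtD (fun j => tower_coord j inv).
rewrite eqn; apply: (exact_mul filtD) exy _.
exact: (exact_exp filtD _ (tower_nonempty r) exx).
Qed.

Lemma coprime_degree r : coprime (q ^ r.+1).-1 q.
Proof.
have q_gt0 : (0 < q ^ r.+1)%N by rewrite expn_gt0 ltnW.
by have := coprimePn q_gt0; rewrite coprime_pexpr.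
Qed.

Lemma tower_invariantP r : tower_invariant r.
Proof.
elim: r => [|r IHr].
  have filtD := base_degree_filtration.
  have D1 : base_filtration 1 (fun s => co s 0).
    apply: (filt_ext filtD) (filt_const filtD 1) => s /eqP ->.
    by rewrite /co.
  split=> //.
  - split; first by exists 'X; rewrite ?size_polyX // => s _; rewrite hornerX.
    by rewrite /= (@base_exact _ _ 'X) ?size_polyX // => s _; rewrite hornerX.
  - split=> //; rewrite /= (@base_exact _ _ 1) ?size_poly1 // => s /eqP ->.
    by rewrite /co hornerC.
  - case=> [|[|j]] //= _; apply: (filt_ext filtD) (filt_zero filtD _) => s /eqP ->.
    by rewrite /co /= nth_nil.
have [filtD exx exy Dco] := IHr; have exF := tower_fun_exact IHr.
have co_n := coprime_degree r.
have filtD' := lift_degree_filtration q_gt1 q_eq0 filtD exF co_n.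
have q_r : (0 < q ^ r)%N by rewrite expn_gt0 ltnW.
have q_rS : (0 < q ^ r.+1)%N by rewrite expn_gt0 ltnW.
have [Dy nDy] := exact_root q_gt1 q_eq0 (tower_fun r) filtD co_n (tower_nonempty r).
split=> //.
- have [Dx nDx] := exact_lift q_gt1 q_eq0 (tower_fun r) filtD co_n exx.
  have eqx : {in tower_locus r.+1, forall s, co (behead s) 1 = co s 1}.
    by move=> s Zs; rewrite (tower_locus_behead Zs).
  rewrite expnS; split; first exact: (filt_ext filtD') Dx.
  by move=> E; apply: nDx; apply: (filt_ext filtD') E => s Zs; rewrite eqx.
- have eqy : {in tower_locus r.+1, forall s, head 0 s = co s r.+2}.
    by move=> s Zs; rewrite (tower_locus_head Zs).
  split; first exact: (filt_ext filtD') Dy.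
  by move=> E; apply: nDy; apply: (filt_ext filtD') E => s Zs; rewrite eqy.
- move=> j j_neq1; have [ltj|] := ltnP j r.+2.
    apply: (filt_ext filtD' (f := fun s => co (behead s) j)).
      by move=> s Zs; rewrite (tower_locus_behead Zs).
    apply: (lift_ext _ (lift_low_monomial q_gt1 _ filtD co_n (ltnW q_gt1) (Dco j j_neq1) _)).
      by move=> s _; rewrite expr0 mulr1.
    by move=> e lte; rewrite addn0 expnS ltn_pmul2l // ltnW.
  rewrite leq_eqVlt => /predU1P[<-|ltj].
    apply: (filt_ext filtD' (f := fun s => head 0 s)).
      by move=> s Zs; rewrite (tower_locus_head Zs).
    by rewrite -(prednK q_rS).
  apply: (filt_ext filtD') (filt_zero filtD' _) => s Zs.
  by rewrite /co nth_default // size_rev (@tower_locus_size r.+1 s Zs).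
Qed.

Lemma tower_spanned r : finitely_spanned (tower_locus r) (tower_filtration r).
Proof.
elim: r => [|r [I [e spanD]]]; first exact: base_spanned.
exists (I * 'I_q)%type,
  (fun (b : I * 'I_q) s => e b.1 (behead s) * head 0 s ^+ b.2) => d f [a [Da fa]].
have /fin_all_exists[c cE] : forall i : 'I_q, exists ci : I -> {poly K},
   {in tower_locus r, forall s, a i s = \sum_b (ci b).[co s 1] * e b s}.
  by move=> i; apply: spanD (Da i (ltn_ord i)).
exists (fun b => c b.2 b.1) => s Zs; rewrite fa // -(pair_bigA _ (fun b i =>
  (c i b).[co s 1] * (e b (behead s) * head 0 s ^+ i))) /=.
rewrite exchange_big; apply: eq_bigr => i _.
have [Zs' _] := andP Zs; rewrite cE // mulr_suml; apply: eq_bigr => b _.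
by rewrite (tower_locus_behead Zs) // mulrA.
Qed.

Lemma tower_fiber_finite r (xs : seq K) :
  exists L : seq T, {in tower_locus r, forall s, co s 1 \in xs -> s \in L}.
Proof.
elim: r => [|r [L finL]].
  exists [seq [:: x; 1] | x <- xs] => s /eqP ->; rewrite /co /= => xs_x.
  by apply/mapP; exists (head 0 s).
suff [L' L'E] : exists L' : seq T, forall y s, s \in L ->
    y ^+ q - y == tower_fun r s -> y :: s \in L'.
  exists L' => -[|y s] Zs; first by have := tower_locus_size Zs.
  rewrite (tower_locus_behead Zs) //= => xs_x; have [Zs' y_root] := andP Zs.
  by apply: L'E => //; apply: finL.
elim: L {finL} => [|t L [L' IHL]]; first by exists [::].
have [rs [_ _ rsE]] := artin_schreier_roots q_gt1 q_eq0 (tower_fun r t).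
exists ([seq y :: t | y <- rs] ++ L') => y s; rewrite mem_cat inE => /predU1P[->|Ls] y_root.
  by rewrite map_f ?rsE.
by rewrite IHL ?orbT.
Qed.

(** The x-coordinates of the zeros are roots of one nonzero polynomial, and each has finitely many
    points above it. Proper closed subsets of the curve are therefore finite, which bounds its
    dimension. *)
Lemma tower_zeros_finite r d f : tower_filtration r d f ->
  ~ {in tower_locus r, forall s, f s = 0} ->
  exists L : seq T, {in tower_locus r, forall s, f s = 0 -> s \in L}.
Proof.
move=> Df nf0; have [filtD [Dx _] _ _] := tower_invariantP r.
have [N N_neq0 fN] := zeros_bounded filtD (tower_spanned r) Dx Df nf0.
have [xs defN] := closed_field_poly_normal N.
have [L LE] := tower_fiber_finite r xs; exists L => s Zs fs0; apply: LE => //.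
have := fN s Zs fs0 => /eqP; rewrite -[_ == 0]/(root N _) defN rootZ ?lead_coef_eq0 //.
by rewrite root_prod_XsubC.
Qed.

Lemma co_drop s k j : (j < size s - k)%N -> co (drop k s) j = co s j.
Proof.
move=> ltj; have sz : size (drop k s) = (size s - k)%N by rewrite size_drop.
rewrite /co !nth_rev ?sz // ?(leq_trans ltj (leq_subr _ _)) // nth_drop.
by congr nth; rewrite -subnDA addnBA ?subnDl // addnS -ltn_subRL.
Qed.

(** The latest coordinates come first in the list, so [drop (r - i)] is the projection to level [i].
    This turns the recursive description into a system of equations. *)
Lemma tower_locusP r s : reflect
  [/\ size s = r.+2, co s 0 = 1 & forall i, (i < r)%N ->
      co s i.+2 ^+ q - co s i.+2 = tower_fun i (drop (r - i) s)]
  (tower_locus r s).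
Proof.
apply: (iffP idP) => [Zs|[]].
  split; [exact: tower_locus_size Zs | exact: tower_locus_co0 Zs |].
  elim: r s Zs => // r IHr [|y s] Zys; first by have := tower_locus_size Zys.
  have /andP[/= Zs /eqP ys] := Zys; have sz := tower_locus_size Zs.
  move=> i; rewrite ltnS leq_eqVlt => /predU1P[->|lti].
    by rewrite co_cons sz ltnn eqxx subSnn /= drop0.
  by rewrite co_cons sz !ltnS lti IHr // subSn // ltnW.
elim: r s => [|r IHr] s; first case: s => [|x [|y []]] //= _.
  by rewrite /co /= => -> _; rewrite /base_locus /=.
case: s => // y s [sz]; rewrite co_cons sz => co0 eqs.
rewrite tower_locusS IHr //=.
  have := eqs r (leqnn _); rewrite co_cons sz ltnn eqxx subSnn /= drop0 => ->.
  by rewrite eqxx.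
move=> i lti; have := eqs i (leqW lti).
by rewrite co_cons sz !ltnS lti subSn // ltnW.
Qed.

End Tower.

End ArtinSchreierTower.

(** * The curves *)

Section Equations.
Variables (p h : nat) (U : {set {ffun 'I_h -> 'F_p}}).
Definition degq := (p ^ h.+2)%N.
Local Notation q := degq.

(** A form of degree [h * p.-1] in x_0, x, y_1, ..., y_(h-1). The last coordinate y_h is absent: it
    is the new unknown of the only equation that contains [spike]. *)
Definition spike (A : comNzRingType) (c : 'F_p -> A) (v : nat -> A) : A :=
  \sum_(u in U) \prod_(j < h) (v 0 ^+ p.-1 - (v j.+1 - c (u j) * v 0) ^+ p.-1).

(* The last equation alone depends on [U]: with [v 0 = 1], [spike] is the
   indicator function of [U] on the [F_p]-points.  Before it, the right-hand
   sides vanish on all [F_p]-points, since [x ^+ q.-1 = x ^+ p.-1] there. *)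
Definition eqn_expr (A : comNzRingType) (c : 'F_p -> A) (v : nat -> A) (r : nat) : A :=
  v r.+2 ^+ q - v r.+2 * v 0 ^+ q.-1
  - v (prev_index r) * (v 1 ^+ q.-1 - v 0 ^+ (q - p) * v 1 ^+ p.-1)
  - (if r.+1 == h then v 0 ^+ (q - h * p.-1) * spike c v else 0).

(** Being written over any commutative ring, one expression serves for polynomials and for values;
    evaluation and base change are both instances of this lemma. *)
Lemma eqn_expr_morph (A B : comNzRingType) (f : {rmorphism A -> B}) c v r :
  f (eqn_expr c v r) = eqn_expr (f \o c) (f \o v) r.
Proof.
rewrite /eqn_expr !(rmorphB, rmorphM, rmorphXn) /= -!rmorphXn; congr (_ - _).
case: ifP => _; last exact: rmorph0.
rewrite rmorphM rmorphXn rmorph_sum; congr (_ * _); apply: eq_bigr => u _.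
by rewrite rmorph_prod; apply: eq_bigr => j _; rewrite !(rmorphB, rmorphM, rmorphXn).
Qed.

Lemma eqn_expr_eq (A : comNzRingType) (c d : 'F_p -> A) (v w : nat -> A) r :
  c =1 d -> (r < h)%N -> (forall j, (j < h.+2)%N -> v j = w j) ->
  eqn_expr c v r = eqn_expr d w r.
Proof.
move=> eqcd ltr eqvw; have eqb : spike c v = spike d w.
  apply: eq_bigr => u _; apply: eq_bigr => j _.
  by rewrite eqcd !eqvw //; have := ltn_ord j; lia.
rewrite /eqn_expr eqb !eqvw //.
by case: r ltr {eqb} => //= r; lia.
Qed.

Definition eqn (r : nat) : {mpoly 'F_p[h.+2]} :=
  eqn_expr (fun c => c%:MP) (fun j => 'X_(inord j)) r.

Definition eqns : seq {mpoly 'F_p[h.+2]} := [seq eqn r | r <- iota 0 h].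

Lemma eqn_eval (x : 'I_h.+2 -> 'F_p) r : (r < h)%N ->
  (eqn r).@[x] = eqn_expr id (fun j => x (inord j)) r.
Proof.
move=> ltr; rewrite (eqn_expr_morph (meval x)).
by apply: eqn_expr_eq => //= [c|j _]; rewrite /= ?mevalC ?mevalXU.
Qed.

Lemma map_eqn (L : fieldType) (c : {rmorphism 'F_p -> L}) r : (r < h)%N ->
  map_mpoly c (eqn r) = eqn_expr (fun a => (c a)%:MP) (fun j => 'X_(inord j)) r
    :> {mpoly L[h.+2]}.
Proof.
move=> ltr; rewrite (eqn_expr_morph (map_mpoly c)).
by apply: eqn_expr_eq => //= [a|j _]; rewrite /= ?map_mpolyC ?map_mpolyX.
Qed.

Lemma map_eqn_eval (L : fieldType) (c : {rmorphism 'F_p -> L}) (x : 'I_h.+2 -> L) r :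
  (r < h)%N -> (map_mpoly c (eqn r)).@[x] = eqn_expr c (fun j => x (inord j)) r.
Proof.
move=> ltr; rewrite map_eqn // (eqn_expr_morph (meval x)).
by apply: eqn_expr_eq => //= [a|j _]; rewrite /= ?mevalC ?mevalXU.
Qed.

Section OverField.
Variables (L : fieldType) (c : 'F_p -> L).

Definition pcoord (P : proj L h.+1) (j : nat) : L := coords P 0 (inord j).

Definition solution (v : nat -> L) := forall r, (r < h)%N -> eqn_expr c v r = 0.

Lemma pinf_subproof : normalized (delta_mx 0 (inord 1) : 'rV[L]_h.+2).
Proof.
apply/existsP; exists (inord 1); rewrite mxE !eqxx /=; apply/forallP => j.
apply/implyP; rewrite inordK // => ltj; rewrite mxE /= -val_eqE /= inordK //.
by case: (j : nat) ltj.
Qed.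

Definition pinf : proj L h.+1 := Proj pinf_subproof.

Lemma pcoord_pinf j : (j < h.+2)%N -> pcoord pinf j = (j == 1%N)%:R.
Proof. by move=> ltj; rewrite /pcoord mxE /= -val_eqE /= !inordK. Qed.

(** Intended for [v 0 = 1], when the vector is normalized; otherwise [pinf] may come out as a
    default value. *)
Definition affine_point (v : nat -> L) : proj L h.+1 := insubd pinf (\row_j v j).

Lemma pcoord_affine v j : v 0 = 1 -> (j < h.+2)%N -> pcoord (affine_point v) j = v j.
Proof.
move=> v0 ltj; rewrite /pcoord -[coords _]/(val _) insubdK ?mxE ?inordK //.
apply/existsP; exists ord0; rewrite mxE v0 eqxx /=; apply/forallP => i.
by [].
Qed.

Lemma proj_eqP (P Q : proj L h.+1) :
  (forall j, (j < h.+2)%N -> pcoord P j = pcoord Q j) -> P = Q.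
Proof.
move=> eqPQ; apply: val_inj; apply/rowP => j.
by have := eqPQ j (ltn_ord j); rewrite /pcoord inord_val.
Qed.

End OverField.

Lemma zero_locus_eqns (P : proj 'F_p h.+1) :
  zero_locus eqns P <-> solution id (pcoord P).
Proof.
split=> [/allP zP r ltr|solP].
  have := zP (eqn r); rewrite map_f ?mem_iota // => /(_ isT)/eqP.
  by rewrite eqn_eval.
rewrite /zero_locus; apply/allP => f /mapP[r]; rewrite mem_iota => /andP[_ ltr] ->.
by rewrite /vanishes eqn_eval //; apply/eqP/solP.
Qed.

Lemma zero_locus_map_eqns (L : fieldType) (c : {rmorphism 'F_p -> L}) (P : proj L h.+1) :
  zero_locus (map (map_mpoly c) eqns) P <-> solution c (pcoord P).
Proof.
split=> [/allP zP r ltr|solP].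
  have := zP (map_mpoly c (eqn r)).
  rewrite map_f ?map_f ?mem_iota // => /(_ isT)/eqP.
  by rewrite map_eqn_eval.
rewrite /zero_locus; apply/allP => f /mapP[g /mapP[r]]; rewrite mem_iota => /andP[_ ltr] -> ->.
by rewrite /vanishes map_eqn_eval //; apply/eqP/solP.
Qed.

Hypothesis p_prime : prime p.


(** The exponents [q - p] and [q - h * p.-1] of x_0 in the correction terms are thus at least 2; the
    exponent [h.+2] in [degq] is large enough for this. *)
Lemma degq_ge : (p + 2 <= q)%N /\ (h * p.-1 + 2 <= q)%N.
Proof.
have p_gt1 := prime_gt1 p_prime; have lth := ltn_expl h p_gt1.
rewrite /degq !expnS; set m := (p ^ h)%N in lth *.
have m_gt0 : (0 < m)%N by apply: leq_ltn_trans lth.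
split; first by have := leq_mul (leq_mul (leqnn p) p_gt1) m_gt0; rewrite muln1 mulnA; lia.
have := leq_mul p_gt1 (leq_mul (leqnn p) lth); rewrite mulnS mulnDr mulnA.
have : (h * p.-1 <= 2 * p * h)%N by rewrite mulnC leq_mul //; lia.
by lia.
Qed.

Lemma degq_gt1 : (1 < q)%N. Proof. have [] := degq_ge; have := prime_gt1 p_prime; lia. Qed.

Section Infinity.
Variables (L : fieldType) (c : 'F_p -> L).

Lemma expr0_pos k : (0 < k)%N -> 0 ^+ k = 0 :> L.
Proof. by move=> k_gt0; rewrite expr0n gtn_eqF. Qed.

Lemma eqn_expr_infinity v r : v 0 = 0 ->
  eqn_expr c v r = v r.+2 ^+ q - v (prev_index r) * v 1 ^+ q.-1.
Proof.
move=> v0; have [q_p q_h] := degq_ge; have p_gt1 := prime_gt1 p_prime.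
rewrite /eqn_expr v0 !expr0_pos; try lia.
by rewrite !mul0r mulr0 !subr0; case: ifP; rewrite subr0.
Qed.

(** On x_0 = 0 the equations become y_(r+1)^q = y_r x^(q-1), and y_0 = x_0 = 0 starts the
    induction. *)
Lemma solution_infinity v : solution c v -> v 0 = 0 ->
  forall r, (r < h)%N -> v r.+2 = 0.
Proof.
move=> sol_v v0; elim=> [|r IHr] ltr; apply/eqP; have := sol_v _ ltr.
  by rewrite eqn_expr_infinity //= v0 mul0r subr0 => /eqP; rewrite expf_eq0 => /andP[].
by rewrite eqn_expr_infinity //= IHr 1?ltnW // mul0r subr0 => /eqP; rewrite expf_eq0 => /andP[].
Qed.

Lemma pinf_solution : solution c (pcoord (pinf L)).
Proof.
move=> r ltr; rewrite eqn_expr_infinity !pcoord_pinf //=; last by case: r ltr => //= r; lia.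
rewrite expr0_pos ?(ltnW degq_gt1) // (_ : _ == _ = false) ?mul0r ?subr0 //.
by case: r ltr.
Qed.

Lemma solution_cases P : solution c (pcoord P) -> pcoord P 0 = 1 \/ P = pinf L.
Proof.
move=> solP; have /existsP[k /andP[/eqP Pk /forallP Pj]] := valP P.
have kE : pcoord P k = 1 by rewrite /pcoord inord_val.
have [P0|P0] := eqVneq (pcoord P 0) 0; [right|left]; last first.
  suff k0 : k = 0 :> nat by rewrite -kE k0.
  apply/eqP; rewrite -leqn0 leqNgt; apply: contra P0 => k_gt0.
  have := Pj (inord 0); rewrite inordK // k_gt0 /=.
  by [].
have Pr := solution_infinity solP P0.
have k1 : k = 1%N :> nat.
  case: (k : nat) kE (ltn_ord k) => [|[|r]] // kE ltk.
    by move: kE; rewrite P0 => /esym/eqP; rewrite oner_eq0.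
  by move: kE; rewrite Pr // => /esym/eqP; rewrite oner_eq0.
apply: proj_eqP => j ltj; rewrite pcoord_pinf //.
case: j ltj => [|[|r]] ltj //=; first by move: kE; rewrite k1.
by rewrite Pr.
Qed.

End Infinity.

Lemma eqns_homogeneous : homogeneous eqns.
Proof.
rewrite /homogeneous; apply/allP => f /mapP[r _ ->].
suff homr : eqn r \is q.-homog for mdeg by have := dhomog_msize homr.
have [q_p q_h] := degq_ge; have p_gt1 := prime_gt1 p_prime.
have homX j : 'X_(inord j) \is [in 'F_p[h.+2], 1.-homog for mdeg].
  by rewrite dhomogX /= mdeg1.
have homE (f1 : {mpoly 'F_p[h.+2]}) k : f1 \is 1.-homog for mdeg -> f1 ^+ k \is k.-homog for mdeg.
  by move=> /(dhomogMn k); rewrite mul1n.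
have homXn j k : 'X_(inord j) ^+ k \is [in 'F_p[h.+2], k.-homog for mdeg].
  exact: homE.
have homM d1 d2 d (f1 f2 : {mpoly 'F_p[h.+2]}) : (d1 + d2)%N = d ->
    f1 \is d1.-homog for mdeg -> f2 \is d2.-homog for mdeg -> f1 * f2 \is d.-homog for mdeg.
  by move=> <-; apply: dhomogM.
rewrite /eqn /eqn_expr !rpredB //.
- by apply: (homM 1%N q.-1); rewrite ?homX ?homXn //; lia.
- apply: (homM 1%N q.-1); rewrite ?homX //; first by lia.
  by rewrite rpredB ?homXn //; apply: (homM (q - p)%N p.-1) => //; lia.
- case: ifP => _; last exact: rpred0.
  apply: (homM (q - h * p.-1)%N (h * p.-1)%N) => //; first by lia.
  rewrite rpred_sum // => u _; rewrite -[h in (h * _)%N]card_ord -sum_nat_const.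
  elim/big_rec2: _ => [|j d f1 _ homf]; first exact: dhomog1.
  apply: dhomogM => //; rewrite rpredB ?homXn //.
  apply: homE; rewrite rpredB ?homX //.
  by rewrite mul_mpolyC rpredZ.
Qed.

End Equations.

(** * Closed and irreducible subsets of projective space *)

Section ZariskiClosed.
Variables (K : fieldType) (n : nat).
Implicit Types (S : seq {mpoly K[n.+1]}) (P Q : proj K n) (Z : pred (proj K n)).

Lemma zero_locusP S P : reflect (forall f, f \in S -> vanishes f P) (zero_locus S P).
Proof. exact: allP. Qed.

Lemma homogeneousP S : reflect (forall f, f \in S -> f \is homog mdeg) (homogeneous S).
Proof. exact: allP. Qed.

Lemma zclosed_witness Z P : zclosed Z -> ~~ Z P ->
  exists f, [/\ f \is homog mdeg, ~~ vanishes f P & forall Q, Z Q -> vanishes f Q].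
Proof.
move=> [S /homogeneousP homS ZS]; rewrite ZS => /allPn[f Sf nfP]; exists f; split=> // [|Q].
  exact: homS.
by rewrite ZS => /zero_locusP; apply.
Qed.

Lemma zclosedU Z1 Z2 : zclosed Z1 -> zclosed Z2 -> zclosed (predU Z1 Z2).
Proof.
move=> [S1 /homogeneousP hom1 Z1E] [S2 /homogeneousP hom2 Z2E].
exists [seq f * g | f <- S1, g <- S2].
  apply/homogeneousP => fg /allpairsP[[f g] /= [Sf Sg ->]].
  by have := dhomogM (hom1 f Sf) (hom2 g Sg) => /dhomog_msize.
move=> P; rewrite /= Z1E Z2E; apply/idP/idP => [/orP[] /zero_locusP zP|/zero_locusP zP].
- by apply/zero_locusP => fg /allpairsP[[f g] /= [/zP/eqP f0 _ ->]]; rewrite /vanishes mevalM f0 mul0r.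
- by apply/zero_locusP => fg /allpairsP[[f g] /= [_ /zP/eqP g0 ->]]; rewrite /vanishes mevalM g0 mulr0.
apply/orP; have [|/allPn[f Sf nf0]] := boolP (zero_locus S1 P); [by left | right].
apply/zero_locusP => g Sg; have := zP (f * g) (allpairs_f _ Sf Sg).
by rewrite /vanishes mevalM mulf_eq0 => /orP[f0|//]; case/negP: nf0.
Qed.

Lemma normalizedP P : exists2 k : 'I_n.+1,
  coords P 0 k = 1 & forall j : 'I_n.+1, (j < k)%N -> coords P 0 j = 0.
Proof.
have /existsP[k /andP[/eqP Pk /forallP Pj]] := valP P; exists k => // j ltj.
by have := Pj j; rewrite ltj => /eqP.
Qed.

(** The equations are the 2 by 2 minors expressing proportionality to the coordinates of [Q];
    between normalized vectors, proportionality is equality. *)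
Lemma zclosed1 Q : zclosed (pred1 Q).
Proof.
pose l (i j : 'I_n.+1) : {mpoly K[n.+1]} := 'X_i * (coords Q 0 j)%:MP - 'X_j * (coords Q 0 i)%:MP.
have lE i j P : (l i j).@[fun j => coords P 0 j] =
    coords P 0 i * coords Q 0 j - coords P 0 j * coords Q 0 i.
  by rewrite mevalB !mevalM !mevalC !mevalXU.
exists [seq l i j | i <- enum 'I_n.+1, j <- enum 'I_n.+1].
  apply/homogeneousP => f /allpairsP[[i j] /= [_ _ ->]].
  suff : l i j \is 1.-homog for mdeg by move/dhomog_msize.
  by rewrite rpredB // mulrC mul_mpolyC rpredZ // dhomogX /= mdeg1.
move=> P; apply/eqP/zero_locusP => [-> f /allpairsP[[i j] /= [_ _ ->]]|zP].
  by rewrite /vanishes lE mulrC subrr.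
have PQ i j : coords P 0 i * coords Q 0 j = coords P 0 j * coords Q 0 i.
  apply/eqP; rewrite -subr_eq0 -lE; apply: zP.
  by apply: allpairs_f; rewrite mem_enum.
have [k Qk Qj] := normalizedP Q; have [l' Pl Pj] := normalizedP P.
have Pi i : coords P 0 i = coords P 0 k * coords Q 0 i by rewrite -PQ Qk mulr1.
have lk : l' = k.
  apply/ord_inj/eqP; rewrite eqn_leq leqNgt [X in _ && X]leqNgt; apply/andP; split; apply/negP => lt.
    by have := Pi l'; rewrite Pl (Pj k lt) mul0r => /eqP; rewrite oner_eq0.
  by have := Pi l'; rewrite Pl (Qj l' lt) mulr0 => /eqP; rewrite oner_eq0.
by apply: val_inj; apply/rowP => i; rewrite [LHS]Pi -lk Pl mul1r.
Qed.

Lemma zclosed_finite (r : seq (proj K n)) : zclosed (fun P => P \in r).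
Proof.
elim: r => [|Q r IHr].
  exists [:: 1].
    apply/homogeneousP => f; rewrite inE => /eqP ->.
    by have /dhomog_msize := @dhomog1 n.+1 K mdeg.
  by move=> P; rewrite /zero_locus /= /vanishes meval1 oner_eq0.
have [S homS SE] := zclosedU (zclosed1 Q) IHr; by exists S.
Qed.

Lemma zirreducible1 Q : zirreducible (pred1 Q).
Proof.
split; first by exists Q; apply: eqxx.
move=> Z1 Z2 _ _ /(_ Q (eqxx Q))/orP[ZQ|ZQ]; [left|right] => P /eqP -> //.
Qed.

(** Points and finite sets are closed, so irreducibility allows the points of [r] to be split off
    one at a time until a single one contains [Z]. *)
Lemma zirreducible_finite Z Q (r : seq (proj K n)) : zirreducible Z ->
  (forall P, Z P -> P \in r) -> Z Q -> zincl Z (pred1 Q).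
Proof.
move=> [_ irrZ] + ZQ; elim: r => [/(_ _ ZQ)//|P r IHr Zr].
have [|ZP|/IHr//] := irrZ _ _ (zclosed1 P) (zclosed_finite r).
  by move=> P' /Zr; rewrite inE.
by move=> P' /ZP /eqP ->; rewrite /= eq_sym; apply: ZP.
Qed.

End ZariskiClosed.

(** * Irreducibility and dimension of the curves *)

Section GeometricCurve.
Variables (p h : nat) (U : {set {ffun 'I_h -> 'F_p}}).
Hypothesis p_prime : prime p.
Variables (K : closedFieldType) (c : {rmorphism 'F_p -> K}).
Local Notation q := (degq p h).
Local Notation T := (seq K).
Local Notation pinf := (pinf h K).
Local Notation Ceqns := (map (map_mpoly c) (eqns U)).
Local Notation C := (zero_locus Ceqns).

Lemma p_eq0 : p%:R = 0 :> K.
Proof. by rewrite -(rmorph_nat c) pchar_Fp_0 ?rmorph0. Qed.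

Lemma degq_eq0 (A : comNzRingType) : p%:R = 0 :> A -> q%:R = 0 :> A.
Proof. by move=> p0; rewrite /degq natrX p0 expr0n. Qed.

(** The value on x_0 = 1 of the correction x_0^2 G_r to the main term y_r x^(q-1). *)
Definition tail r (s : T) : K :=
  - (co s (prev_index r) * co s 1 ^+ p.-1)
  + (if r.+1 == h then spike U c (co s) else 0).

Local Notation locus := (tower_locus q tail).
Local Notation filtration := (tower_filtration q tail).

(** All coordinates have order at most q^r, so the two terms have order at most p q^r and h (p - 1)
    q^r. Both are at most (q - 2) q^r, which is less than q^(r+1) - 1. *)
Lemma tail_lower_order r : degree_filtration (locus r) (filtration r) ->
  (forall j, filtration r (q ^ r).+1 (fun s => co s j)) ->
  filtration r (q ^ r.+1).-1 (tail r).
Proof.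
move=> filtD Dco; have [q_p q_h] := degq_ge h p_prime; have p_gt1 := prime_gt1 p_prime.
have q_r : (0 < q ^ r)%N by rewrite expn_gt0; lia.
have le_deg k : (k + 2 <= q)%N -> ((k * q ^ r).+1 <= (q ^ r.+1).-1)%N.
  by move=> lek; have := leq_mul lek (leqnn (q ^ r)); rewrite -expnS mulnDl; lia.
apply: (filt_add filtD).
  apply: (filt_opp filtD).
  have := filt_mul filtD (Dco (prev_index r)) (filt_exp filtD p.-1 (Dco 1%N)).
  by apply: (filt_le filtD); rewrite addSn -mulSn le_deg // prednK //; lia.
case: (r.+1 == h); last exact: filt_zero filtD _.
rewrite /spike.
apply: (filt_le filtD (le_deg _ q_h)); apply: (filt_sum filtD) => u _.
apply: (filt_le filtD (d := (\sum_(j < h) (p.-1 * q ^ r)).+1)).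
  by rewrite sum_nat_const card_ord mulnA.
apply: (filt_prod filtD) => j _; apply: (filt_sub filtD).
  by have := filt_exp filtD p.-1 (Dco 0%N).
apply: (filt_exp filtD); apply: (filt_sub filtD) => //.
have := filt_mul filtD (Dco 0%N) (filt_const filtD (c (u j))); rewrite addn0.
by apply: (filt_ext filtD) => s _; rewrite mulrC.
Qed.

Let q_gt1 := degq_gt1 h p_prime.
Let q_eq0 := degq_eq0 p_eq0.

Lemma curve_invariant : tower_invariant q tail h.
Proof. refine (tower_invariantP q_gt1 q_eq0 (@tail_lower_order) h). Qed.

Lemma locus_solution s : size s = h.+2 -> co s 0 = 1 ->
  locus h s <-> solution U c (co s).
Proof.
move=> sz co0; have [q_p q_h] := degq_ge h p_prime; have p_gt1 := prime_gt1 p_prime.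
have eqnE r : (r < h)%N -> eqn_expr U c (co s) r =
    co s r.+2 ^+ q - co s r.+2 - tower_fun q tail r (drop (h - r) s).
  move=> ltr; have drE j : (j < r.+2)%N -> co (drop (h - r) s) j = co s j.
    by move=> ltj; rewrite co_drop // sz; lia.
  rewrite /eqn_expr /tower_fun /tail !drE //; last by case: (r).
  rewrite co0 !expr1n mulr1 !mul1r.
  have -> : (if r.+1 == h then spike U c (co (drop (h - r) s)) else 0)
          = (if r.+1 == h then spike U c (co s) else 0).
    case: eqP => // rh; apply: eq_bigr => u _; apply: eq_bigr => j _.
    by rewrite !drE // rh ltnS ltn_ord.
  by move: (_ ^+ q) (_ ^+ q.-1) (_ ^+ p.-1) (if _ then _ else _) => a b d e; ring.
split=> [/tower_locusP[_ _ eqs] r ltr|sols]; first by rewrite eqnE // eqs ?subrr.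
apply/tower_locusP; split=> // r ltr; apply/eqP; rewrite -subr_eq0 -eqnE //.
by rewrite sols.
Qed.

Definition evals (f : {mpoly K[h.+2]}) (s : T) : K := f.@[fun j => co s j].

Lemma filt_monomial (m : 'X_{1..h.+2}) :
  filtration h (mdeg m * q ^ h).+1 (fun s => \prod_(i < h.+2) co s i ^+ m i).
Proof.
have [filtD _ _ _] := curve_invariant.
rewrite mdegE big_distrl; apply: (filt_prod filtD) => i _.
exact: (filt_exp filtD) (tower_coord _ curve_invariant).
Qed.

Lemma base_change_homogeneous : homogeneous Ceqns.
Proof.
apply/homogeneousP => f /mapP[g g_eqns ->].
have /homogeneousP/(_ g g_eqns)/dhomogP homg := eqns_homogeneous U p_prime.
suff : map_mpoly c g \is (mmeasure mdeg g).-1.-homog for mdeg by move/dhomog_msize.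
apply/dhomogP => m; rewrite mcoeff_msupp mcoeff_map_mpoly => gm.
by apply: homg; rewrite mcoeff_msupp; apply: contraNneq gm => ->; rewrite raddf0.
Qed.

Lemma evals_regular f : exists d, filtration h d (evals f).
Proof.
have [filtD _ _ _] := curve_invariant; exists (msize f * q ^ h).+1.
apply: (filt_ext filtD (f := fun s =>
  \sum_(m <- msupp f | m \in msupp f) f@_m * \prod_(i < h.+2) co s i ^+ m i)).
  by move=> s _; rewrite /evals mevalE -big_seq.
apply: (filt_sum filtD) => m m_f.
have := filt_mul filtD (filt_const filtD f@_m) (filt_monomial m); rewrite add1n.
apply: (filt_le filtD); rewrite ltnS leq_mul2r; apply/orP; right.
by rewrite ltnW // msize_mdeg_lt.
Qed.

(* The coordinate [x] has degree [q ^ h] and the other ones have smaller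
   degree, so the pole of a form of degree [d] has order [d * q ^ h] exactly
   when the coefficient of [x ^+ d], its value at infinity, is not zero. *)
Lemma evals_leading f d : f \is d.-homog for mdeg ->
  filtration h (d * q ^ h)%N (fun s => evals f s - f.@[fun j => coords pinf 0 j] * co s 1 ^+ d).
Proof.
have [filtD _ _ Dco] := curve_invariant; move/dhomogP => homf.
apply: (filt_ext filtD (f := fun s => \sum_(m <- msupp f | m \in msupp f)
  (f@_m * (\prod_(i < h.+2) co s i ^+ m i - (\prod_i coords pinf 0 i ^+ m i) * co s 1 ^+ d)))).
  move=> s _; rewrite /evals !mevalE -big_seq mulr_suml -sumrB; apply: eq_bigr => m _.
  by rewrite mulrBr mulrA.
apply: (filt_sum filtD) => m m_f.
suff Dm : filtration h (d * q ^ h)%N (fun s =>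
    \prod_(i < h.+2) co s i ^+ m i - (\prod_i coords pinf 0 i ^+ m i) * co s 1 ^+ d).
  have := filt_mul filtD Dm (filt_const filtD f@_m); rewrite addn0.
  by apply: (filt_ext filtD) => s _; rewrite mulrC.
pose i1 : 'I_h.+2 := inord 1.
have pinfE i : coords pinf 0 i = (i == i1)%:R by rewrite mxE eqxx.
(* A monomial containing a coordinate other than x vanishes at [pinf], and that factor, of order
   less than q^h, brings the total below d q^h. The only other monomial is x^d, for which the
   difference is zero. *)
have [[i [i_neq1 mi_gt0]]|m_i1] := classic (exists i, i != i1 /\ (0 < m i)%N).
  rewrite -(homf m m_f) /= mdegE; apply: (filt_ext filtD (f := fun s =>
      co s i * (co s i ^+ (m i).-1 * \prod_(j | j != i) co s j ^+ m j))).
    move=> s _; rewrite [X in _ = _ - X * _](bigD1 i) //= pinfE (negPf i_neq1).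
    rewrite expr0n gtn_eqF // !mul0r subr0 [RHS](bigD1 i) //=.
    by rewrite mulrA -exprS prednK.
  have D1 := filt_prod filtD (index_enum _) (P := fun j => j != i)
    (fun j _ => filt_exp filtD (m j) (tower_coord j curve_invariant)).
  have D2 : filtration h ((m i).-1 * q ^ h + \sum_(j | j != i) m j * q ^ h)%N.+1
      (fun s => co s i ^+ (m i).-1 * \prod_(j | j != i) co s j ^+ m j).
    rewrite -addSn; apply: (filt_mul filtD) D1.
    by have := filt_exp filtD (m i).-1 (tower_coord i curve_invariant).
  have i_ne : (i : nat) != 1%N.
    by apply: contra i_neq1 => /eqP i1E; apply/eqP/ord_inj; rewrite inordK.
  have := filt_mul filtD (Dco _ i_ne) D2.
  by rewrite -big_distrl /= addnA -mulSn prednK // -mulnDl [in X in _ -> X](bigD1 i).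
have m0 i : i != i1 -> m i = 0%N.
  move=> i_neq1; apply/eqP; rewrite -leqn0 leqNgt; apply/negP => mi_gt0.
  by apply: m_i1; exists i.
apply: (filt_ext filtD) (filt_zero filtD _) => s _.
have dE : d = m i1.
  rewrite -(homf m m_f) /= mdegE (bigD1 i1) //= big1 ?addn0 //.
rewrite (bigD1 i1) //= [X in _ = _ - X * _](bigD1 i1) //= pinfE eqxx expr1n !big1.
- by rewrite mulr1 !mul1r dE inordK ?subrr.
- by move=> i /m0 ->; rewrite expr0.
- by move=> i /m0 ->; rewrite expr0.
Qed.

(** If the value at infinity were nonzero, [evals_leading] would give x^d an order below d q^h. In
    other words, [pinf] lies in the closure of the affine part, so forms may be tested there. *)
Lemma evals_infinity f d : f \is d.-homog for mdeg ->
  {in locus h, forall s, evals f s = 0} -> f.@[fun j => coords pinf 0 j] = 0.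
Proof.
have [filtD exx _ _] := curve_invariant; move=> homf f0.
have [_ nDx] := exact_exp filtD d (tower_nonempty q_gt1 q_eq0 tail h) exx.
have := evals_leading homf; set a := f.@[_]; move=> Da.
have [//|a_neq0] := eqVneq a 0; case: nDx.
have := filt_mul filtD Da (filt_const filtD (- a^-1)); rewrite addn0.
apply: (filt_ext filtD) => s Zs; rewrite f0 // sub0r mulrNN mulrAC mulfV ?mul1r //.
Qed.

Lemma pcoord_pinf0 : pcoord pinf 0 = 0.
Proof. by rewrite pcoord_pinf. Qed.

Lemma affine_point_co s j : locus h s -> (j < h.+2)%N ->
  pcoord (affine_point h (co s)) j = co s j.
Proof. by move=> Zs ltj; rewrite pcoord_affine // (tower_locus_co0 Zs). Qed.

Lemma geom_points_affine s : locus h s -> C (affine_point h (co s)).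
Proof.
move=> Zs; apply/zero_locus_map_eqns => r ltr.
have /(locus_solution (tower_locus_size Zs) (tower_locus_co0 Zs)) sols := Zs.
rewrite -(sols r ltr); apply: eqn_expr_eq => // j ltj.
exact: affine_point_co.
Qed.

Lemma geom_points_pinf : C pinf.
Proof. exact/zero_locus_map_eqns/pinf_solution. Qed.

Lemma geom_points_cases P : C P ->
  P = pinf \/ exists2 s, locus h s & P = affine_point h (co s).
Proof.
move=> /zero_locus_map_eqns solP; have [P0|->] := solution_cases p_prime solP; last by left.
right; pose s := rev (mkseq (pcoord P) h.+2).
have szs : size s = h.+2 by rewrite size_rev size_mkseq.
have coE j : (j < h.+2)%N -> co s j = pcoord P j.
  by move=> ltj; rewrite /co revK nth_mkseq.
have Zs : locus h s.
  apply/(locus_solution szs); first by rewrite coE.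
  by move=> r ltr; rewrite -(solP r ltr); apply: eqn_expr_eq.
by exists s => //; apply: proj_eqP => j ltj; rewrite affine_point_co // coE.
Qed.

Lemma vanishes_affine f s : locus h s ->
  vanishes f (affine_point h (co s)) = (evals f s == 0).
Proof.
move=> Zs; congr (_ == _); apply: meval_eq => j.
by rewrite -affine_point_co // /pcoord inord_val.
Qed.

Lemma form_nonzero f P : f \is homog mdeg -> C P -> ~~ vanishes f P ->
  ~ {in locus h, forall s, evals f s = 0}.
Proof.
move=> homf /geom_points_cases[->|[s Zs ->]] nfP f0; case/negP: nfP.
  by rewrite /vanishes; apply/eqP; apply: evals_infinity homf f0.
by rewrite vanishes_affine // f0.
Qed.

(** If neither closed set contained the curve, there would be two forms, not zero on the affine
    part, whose product vanishes on it; but the functions there form a domain. *)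
Lemma curve_irreducible : zirreducible C.
Proof.
split; first by exists pinf; apply: geom_points_pinf.
move=> Z1 Z2 cl1 cl2 Zsub; apply: NNPP => /not_or_and[nZ1 nZ2].
have [P1 [ZP1 nZP1]] : exists P, C P /\ ~~ Z1 P.
  apply: NNPP => nex; apply: nZ1 => P ZP; apply: contraT => nZP.
  by case: nex; exists P.
have [P2 [ZP2 nZP2]] : exists P, C P /\ ~~ Z2 P.
  apply: NNPP => nex; apply: nZ2 => P ZP; apply: contraT => nZP.
  by case: nex; exists P.
have [f1 [hom1 /(form_nonzero hom1 ZP1) nf1 f1Z]] := zclosed_witness cl1 nZP1.
have [f2 [hom2 /(form_nonzero hom2 ZP2) nf2 f2Z]] := zclosed_witness cl2 nZP2.
have [filtD _ _ _] := curve_invariant.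
have [d1 D1] := evals_regular f1; have [d2 D2] := evals_regular f2.
have [|//|//] := filt_integral filtD D1 D2 => s Zs.
have /orP[/f1Z|/f2Z] := Zsub _ (geom_points_affine Zs); rewrite vanishes_affine // => /eqP ->.
  by rewrite mul0r.
by rewrite mulr0.
Qed.

(** The point [pinf] inside the curve is a chain of length 1. In a chain of length 2 the middle term
    lies in the zeros of a form that is not zero on the curve; it is then finite and irreducible,
    hence a point, and cannot contain the bottom term strictly. *)
Lemma curve_dimension : krull_dim_is C 1.
Proof.
split.
  exists (fun i => if i is 0 then (pred1 pinf : pred (proj K h.+1)) else C); split.
    case=> [|i] _; split=> //.
    - exact: zclosed1.
    - exact: zirreducible1.
    - by move=> P /eqP ->; apply: geom_points_pinf.
    - by exists Ceqns; first exact: base_change_homogeneous.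
    - exact: curve_irreducible.
  case=> // _; split=> [P /eqP ->|inc]; first exact: geom_points_pinf.
  have [s Zs] := tower_nonempty q_gt1 q_eq0 tail h.
  have /eqP s_inf := inc _ (geom_points_affine Zs).
  have := affine_point_co Zs (ltn0Sn _); rewrite s_inf pcoord_pinf0 (tower_locus_co0 Zs).
  by move/eqP; rewrite eq_sym oner_eq0.
move=> [Y [YE Yinc]].
have [cl0 irr0 _] := YE 0 isT; have [cl1 irr1 _] := YE 1%N isT.
have [cl2 irr2 C2Z] := YE 2%N isT.
have [C01 nC10] := Yinc 0 isT; have [C12 nC21] := Yinc 1%N isT.
have [P [C2P nC1P]] : exists P, Y 2%N P /\ ~~ Y 1%N P.
  apply: NNPP => nex; apply: nC21 => P C2P; apply: contraT => nC1P.
  by case: nex; exists P.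
have [f [homf /(form_nonzero homf (C2Z _ C2P)) nf0 fC1]] := zclosed_witness cl1 nC1P.
have [d Df] := evals_regular f.
have [L LE] := tower_zeros_finite q_gt1 q_eq0 (@tail_lower_order) Df nf0.
have [[A C0A] _] := irr0.
apply: nC10 => Q C1Q.
have finC1 P' : Y 1%N P' -> P' \in pinf :: [seq affine_point h (co s) | s <- L].
  move=> C1P'; have [->|[s Zs P'E]] := geom_points_cases (C2Z _ (C12 _ C1P')).
    exact: mem_head.
  rewrite inE; apply/orP; right; apply/mapP; exists s => //; apply: LE => //; apply/eqP.
  by rewrite -vanishes_affine // -P'E fC1.
by have /eqP -> := zirreducible_finite irr1 finC1 (C01 _ C0A) C1Q.
Qed.

End GeometricCurve.

(** * Smoothness by the Jacobian criterion *)

Section DerivativeAt.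
Variables (K : fieldType) (n : nat) (x : 'I_n -> K) (a : 'I_n).

Definition deriv_at (f : {mpoly K[n]}) : K := (mderiv a f).@[x].

Lemma deriv_atB f g : deriv_at (f - g) = deriv_at f - deriv_at g.
Proof. by rewrite /deriv_at mderivB mevalB. Qed.

Lemma deriv_atD f g : deriv_at (f + g) = deriv_at f + deriv_at g.
Proof. by rewrite /deriv_at mderivD mevalD. Qed.

Lemma deriv_at0 : deriv_at 0 = 0.
Proof. by rewrite /deriv_at mderiv0 meval0. Qed.

Lemma deriv_atC k : deriv_at k%:MP = 0.
Proof. by rewrite /deriv_at mderivC meval0. Qed.

Lemma deriv_atM f g : deriv_at (f * g) = deriv_at f * g.@[x] + f.@[x] * deriv_at g.
Proof. by rewrite /deriv_at mderivM mevalD !mevalM. Qed.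

Lemma deriv_atXn f k : deriv_at (f ^+ k) = f.@[x] ^+ k.-1 * deriv_at f *+ k.
Proof.
elim: k => [|k IHk]; first by rewrite expr0 -mpolyC1 deriv_atC mulr0n.
rewrite exprS deriv_atM IHk rmorphXn mulrnAr mulrA mulrC mulrS; congr (_ + _).
by case: k {IHk} => [|k]; rewrite ?mulr0n // -exprS.
Qed.

Lemma deriv_atX i : deriv_at 'X_i = (i == a)%:R.
Proof.
rewrite /deriv_at mderivX mevalZ mnm1E; case: eqP => [->|_]; last by rewrite mul0r.
have -> : (U_(a) - U_(a))%MM = 0%MM :> 'X_{1..n} by apply/mnmP => j; rewrite mnmBE subnn mnm0E.
by rewrite mpolyX0 meval1 mulr1.
Qed.

End DerivativeAt.

Section SmoothCurve.
Variables (p h : nat) (U : {set {ffun 'I_h -> 'F_p}}).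
Hypothesis p_prime : prime p.
Variables (K : closedFieldType) (c : {rmorphism 'F_p -> K}).
Local Notation q := (degq p h).
Local Notation pinf := (pinf h K).
Local Notation Ceqns := (map (map_mpoly c) (eqns U)).
Local Notation C := (zero_locus Ceqns).

Lemma size_Ceqns : size Ceqns = h.
Proof. by rewrite !size_map size_iota. Qed.

Lemma jacobian_eqns (P : proj K h.+1) i a : jacobian Ceqns P i a =
  deriv_at (fun j => coords P 0 j) a
    (eqn_expr U (fun b => (c b)%:MP) (fun j => 'X_(inord j)) i).
Proof.
have lti : (i < h)%N by have := ltn_ord i; rewrite [X in (_ < X)%N]size_Ceqns.
have sz : size (eqns U) = h by rewrite size_map size_iota.
rewrite mxE (nth_map 0) ?sz // /eqns (nth_map 0%N) ?size_iota // nth_iota //.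
by rewrite add0n map_eqn.
Qed.

Section Entries.
Variables (P : proj K h.+1) (a : nat) (lta : (a < h.+2)%N).
Local Notation D := (deriv_at (fun j => coords P 0 j) (inord a)).
Local Notation v := (pcoord P).
Local Notation X := (fun j => 'X_(inord j) : {mpoly K[h.+2]}).
Local Notation cc := (fun b => (c b)%:MP).

Lemma deriv_coord j : (j < h.+2)%N -> D (X j) = (j == a)%:R.
Proof. by move=> ltj; rewrite deriv_atX -val_eqE /= !inordK. Qed.

Lemma deriv_spike : (h < a)%N -> D (spike U cc X) = 0.
Proof.
move=> lta'; have DX j : (j < h.+1)%N -> D (X j) = 0.
  by move=> ltj; rewrite deriv_coord ?ltn_eqF //; lia.
rewrite /spike; elim/big_rec: _ => [|u f _ Df]; first exact: deriv_at0.
rewrite deriv_atD Df addr0; elim/big_rec: _ => [|j g _ Dg]; first by rewrite -mpolyC1 deriv_atC.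
have ltj := ltn_ord j.
rewrite deriv_atM Dg mulr0 addr0 deriv_atB !deriv_atXn !(deriv_atB, deriv_atM) deriv_atC !DX //.
by rewrite !(mulr0, mul0r, add0r, subr0, mul0rn, oppr0).
Qed.

Lemma deriv_eqn r : (r < h)%N -> D (eqn_expr U cc X r) =
  - (D (X r.+2) * v 0 ^+ q.-1 + v r.+2 * (v 0 ^+ q.-2 * D (X 0) *+ q.-1))
  - (D (X (prev_index r)) * (v 1 ^+ q.-1 - v 0 ^+ (q - p) * v 1 ^+ p.-1)
     + v (prev_index r) *
       (v 1 ^+ q.-2 * D (X 1) *+ q.-1
        - (v 0 ^+ (q - p).-1 * D (X 0) *+ (q - p) * v 1 ^+ p.-1
           + v 0 ^+ (q - p) * (v 1 ^+ p.-2 * D (X 1) *+ p.-1))))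
  - (if r.+1 == h then
       v 0 ^+ (q - h * p.-1).-1 * D (X 0) *+ (q - h * p.-1) * (spike U cc X).@[fun j => coords P 0 j]
       + v 0 ^+ (q - h * p.-1) * D (spike U cc X)
     else 0).
Proof.
move=> ltr; have Xv j : ('X_(inord j)).@[fun j : 'I_h.+2 => coords P 0 j] = v j.
  by rewrite mevalXU.
(* The derivative of the q-th power carries the factor q = 0. *)
rewrite /eqn_expr !deriv_atB deriv_atXn -[X in X - _ - _ - _]mulr_natr.
rewrite (degq_eq0 h (p_eq0 p_prime c)) mulr0 sub0r.
congr (- _ - _ - _).
- by rewrite deriv_atM deriv_atXn rmorphXn /= !Xv.
- by rewrite deriv_atM !deriv_atB !deriv_atM !deriv_atXn mevalB mevalM !rmorphXn /= !Xv.
- case: ifP => _; last exact: deriv_at0.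
  by rewrite deriv_atM deriv_atXn !rmorphXn /= !Xv.
Qed.

End Entries.

Lemma curve_smooth (P : proj K h.+1) : C P -> smooth_at Ceqns 1 P.
Proof.
move=> CP; rewrite /smooth_at addn1; congr _.+1.
have [q_p q_h] := degq_ge h p_prime; have p_gt1 := prime_gt1 p_prime.
suff /eqP -> : row_free (jacobian Ceqns P) by rewrite size_Ceqns.
rewrite -kermx_eq0; apply/rowV0P => u /sub_kermxP uJ0.
pose w r : K := if insub r is Some i then u 0 i else 0.
have uw i : u 0 i = w i by rewrite /w valK.
pose J r a := deriv_at (fun j => coords P 0 j) (inord a)
    (eqn_expr U (fun b => (c b)%:MP) (fun j => 'X_(inord j)) r).
have sum0 a : \sum_(r < size Ceqns) w r * J r a = 0.
  have := congr1 (fun A : 'rV_h.+2 => A 0 (inord a)) uJ0; rewrite !mxE => uJ.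
  rewrite -[RHS]uJ; apply: eq_bigr => i _.
  by rewrite jacobian_eqns uw.
suff w0 r : (r < h)%N -> w r = 0.
  by apply/rowP => i; rewrite mxE uw w0 //; have := ltn_ord i; rewrite [X in (_ < X)%N]size_Ceqns.
case: (geom_points_cases p_prime CP) => [Pinf|[s Zs Pa]].
  move=> ltr; have lt_r : (prev_index r < h.+2)%N by case: (r) ltr => //= r'; lia.
  have JE i : (i < h)%N -> J i (prev_index r) = - (i == r)%:R.
    move=> lti; have lt_i : (prev_index i < h.+2)%N by case: (i) lti => //= i'; lia.
    rewrite /J deriv_eqn // !(deriv_coord _ lt_r) // Pinf !pcoord_pinf // !expr0_pos; try lia.
    rewrite (_ : (prev_index i == 1%N) = false) ?expr1n; last by case: (i).
    rewrite (_ : (prev_index i == prev_index r) = (i == r)); last first.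
      by case: (i) (r) => [|i'] [|r'].
    case: ifP => _; by rewrite !(mulr0, mul0r, mul0rn, addr0, subr0, oppr0, sub0r, mulr1).
  have := sum0 (prev_index r); have ltr' : (r < size Ceqns)%N by rewrite size_Ceqns.
  rewrite (bigD1 (Ordinal ltr')) //= JE // eqxx mulrN1 big1 ?addr0 => [/eqP|i].
    by rewrite oppr_eq0 => /eqP.
  have lti : (i < h)%N by have := ltn_ord i; rewrite [X in (_ < X)%N]size_Ceqns.
  by rewrite -val_eqE JE //= => /negPf ->; rewrite oppr0 mulr0.
have P0 : pcoord P 0 = 1 by rewrite Pa (affine_point_co Zs) // (tower_locus_co0 Zs).
have JE i j : (i <= j)%N -> (j < h)%N -> J i j.+2 = - (i == j)%:R.
  move=> leij ltj; have lti := leq_ltn_trans leij ltj.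
  rewrite /J deriv_eqn // !deriv_coord //; try (by case: (i) lti => //= i'; lia).
  have -> : (prev_index i == j.+2) = false by case: (i) leij => //= i'; lia.
  rewrite (_ : (if i.+1 == h then _ else 0) = 0 :> K); last first.
    by case: eqP => // ih; rewrite deriv_spike //= ?(mulr0, mul0r, mul0rn, addr0) //; lia.
  by rewrite P0 !expr1n /= !(mulr0, mul0r, mul0rn, addr0, subr0, oppr0, sub0r, mulr1).
(* Equations after the [r]-th may involve y_(r+1), so the coefficients of the linear relation are
   shown to vanish starting from the last one. *)
have [k] := ubnP (h - r); elim: k r => // k IHk r ltk ltr.
have ltr' : (r < size Ceqns)%N by rewrite size_Ceqns.
have := sum0 r.+2; rewrite (bigD1 (Ordinal ltr')) //= JE // eqxx mulrN1 big1 ?addr0 => [/eqP|i].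
  by rewrite oppr_eq0 => /eqP.
rewrite -val_eqE /= neq_ltn => /orP[lti|gti]; first by rewrite JE ?ltn_eqF ?oppr0 ?mulr0 // ltnW.
have lti : (i < h)%N by have := ltn_ord i; rewrite [X in (_ < X)%N]size_Ceqns.
by rewrite IHk ?mul0r //; lia.
Qed.

End SmoothCurve.

(** * Points over F_p and the family of curves *)

Section RationalPoints.
Variables (p h : nat).
Hypotheses (p_prime : prime p) (h_gt0 : (0 < h)%N).
Local Notation q := (degq p h).
Local Notation F := 'F_p.
Local Notation pinf := (pinf h F).

Lemma Fp_exp_pchar (x : F) k : x ^+ (p ^ k) = x.
Proof.
elim: k => [|k IHk]; first by rewrite expn0 expr1.
by rewrite expnSr exprM IHk -[in RHS](expf_card x) card_Fp.
Qed.

Lemma expr_pred_fixed (x : F) k : (1 < k)%N -> x ^+ k = x -> x ^+ k.-1 = (x != 0)%:R.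
Proof.
case: k => [|[|k]] // _ xk; have [->|x_neq0] := eqVneq x 0; first by rewrite expr0n.
by apply: (mulfI x_neq0); rewrite -exprS xk mulr1.
Qed.

(** By Fermat x^(p-1) is 0 at 0 and 1 elsewhere, so each product over [j] is the indicator of the
    single point [u]. *)
Lemma spike_Fp (U : {set {ffun 'I_h -> F}}) (v : nat -> F) : v 0 = 1 ->
  spike U id v = ([ffun j : 'I_h => v j.+1] \in U)%:R.
Proof.
move=> v0; have E (x : F) : x ^+ p.-1 = (x != 0)%:R.
  exact: expr_pred_fixed (prime_gt1 p_prime) (Fp_exp_pchar x 1).
have prodE (u : {ffun 'I_h -> F}) : \prod_(j < h) (v 0 ^+ p.-1 - (v j.+1 - id (u j) * v 0) ^+ p.-1)
    = ([ffun j : 'I_h => v j.+1] == u)%:R.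
  have [eqv|neqv] := eqVneq.
    apply: big1 => j _; rewrite v0 expr1n mulr1 E -eqv ffunE subrr eqxx.
    by rewrite subr0.
  have [j vj] : exists j : 'I_h, v j.+1 != u j.
    apply/existsP; rewrite -negb_forall; apply: contra neqv => /forallP vu.
    by apply/eqP/ffunP => j; rewrite ffunE; apply/eqP.
  by rewrite (bigD1 j) //= v0 expr1n mulr1 E subr_eq0 vj subrr mul0r.
rewrite /spike; under eq_bigr do rewrite prodE.
rewrite big_mkcond /= (bigD1 [ffun j : 'I_h => v j.+1]) //= eqxx big1 ?addr0; first by case: ifP.
by move=> u; rewrite eq_sym => /negPf ->; case: ifP.
Qed.

Lemma solution_Fp (U : {set {ffun 'I_h -> F}}) (v : nat -> F) : v 0 = 1 ->
  solution U id v <-> [ffun j : 'I_h => v j.+1] \notin U.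
Proof.
move=> v0; have eqnE r : eqn_expr U id v r =
    - (if r.+1 == h then ([ffun j : 'I_h => v j.+1] \in U)%:R else 0).
  rewrite /eqn_expr spike_Fp // v0 !expr1n mulr1 !mul1r Fp_exp_pchar subrr.
  have E k : (1 < k)%N -> v 1%N ^+ k = v 1%N -> v 1%N ^+ k.-1 = (v 1%N != 0)%:R.
    exact: expr_pred_fixed.
  rewrite !E ?Fp_exp_pchar ?degq_gt1 ?prime_gt1 //; last exact: (Fp_exp_pchar _ 1).
  by rewrite subrr mulr0 subr0 sub0r.
split=> [solv|nU r _]; last by rewrite eqnE (negPf nU) if_same oppr0.
have := solv h.-1; rewrite prednK // eqnE prednK // eqxx => /(_ (leqnn _))/eqP.
by rewrite oppr_eq0; case: (_ \in U) => //; rewrite oner_eq0.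
Qed.

(** The vector (1, z_0, ..., z_(h-1), y): [insub] fails from [h] on, which supplies the last entry
    [y]. *)
Definition point_vector (z : {ffun 'I_h -> F}) (y : F) (j : nat) : F :=
  if j is j'.+1 then oapp z y (insub j') else 1.

Lemma point_vectorK z y : [ffun j : 'I_h => point_vector z y j.+1] = z.
Proof. by apply/ffunP => j; rewrite ffunE /= valK. Qed.

Lemma point_vector_last z y : point_vector z y h.+1 = y.
Proof. by rewrite /= insubF ?ltnn. Qed.

Definition curve_point (zy : {ffun 'I_h -> F} * F) : proj F h.+1 :=
  affine_point h (point_vector zy.1 zy.2).

Lemma pcoord_curve_point zy j : (j < h.+2)%N ->
  pcoord (curve_point zy) j = point_vector zy.1 zy.2 j.
Proof. exact: pcoord_affine. Qed.

Lemma curve_point_inj : injective curve_point.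
Proof.
move=> [z y] [z' y'] eqP; have eqv j : (j < h.+2)%N -> point_vector z y j = point_vector z' y' j.
  move=> ltj; have := pcoord_curve_point (z, y) ltj; rewrite eqP => <-.
  exact: pcoord_curve_point.
congr (_, _); last by have := eqv _ (leqnn _); rewrite !point_vector_last.
rewrite -(point_vectorK z y) -(point_vectorK z' y'); apply/ffunP => j; rewrite !ffunE.
by apply: eqv; rewrite ltnS ltnW // ltnS.
Qed.

Lemma rational_points (U : {set {ffun 'I_h -> F}}) :
  [set P | zero_locus (eqns U) P] = pinf |: curve_point @: setX (~: U) setT.
Proof.
apply/setP => P; rewrite !inE; apply/idP/orP => [/zero_locus_eqns solP|[/eqP->|]].
- have [P0|->] := solution_cases p_prime solP; last by left.
  right; apply/imsetP; exists ([ffun j : 'I_h => pcoord P j.+1], pcoord P h.+1).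
    by rewrite !inE andbT; apply/solution_Fp.
  apply: proj_eqP => -[|j] ltj; first by rewrite pcoord_curve_point.
  rewrite pcoord_curve_point //= ; case: insubP => [i _ <-|]; first by rewrite /= ffunE.
  by rewrite -leqNgt => lehj; congr pcoord; lia.
- exact/zero_locus_eqns/pinf_solution.
case/imsetP => -[z y]; rewrite !inE andbT => /= nzU ->; apply/zero_locus_eqns => r ltr.
have /(_ r ltr) <- : solution U id (point_vector z y).
  by apply/solution_Fp; rewrite ?point_vectorK.
by apply: eqn_expr_eq => // j ltj; rewrite pcoord_curve_point.
Qed.

Lemma card_rational_points (U : {set {ffun 'I_h -> F}}) :
  #|[set P | zero_locus (eqns U) P]| = (1 + p * (p ^ h - #|U|))%N.
Proof.
have cardU : #|~: U| = (p ^ h - #|U|)%N.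
  have := cardsC U; rewrite card_ffun card_ord => /(canRL (addKn _)) ->.
  by congr (_ ^ _ - _)%N; [apply: Fp_cast | apply: card_ord].
have cardX : #|setX (~: U) [set: F]| = (p * (p ^ h - #|U|))%N.
  by rewrite cardsX cardU mulnC cardsT; congr (_ * _)%N; apply: card_Fp.
rewrite rational_points cardsU1 (card_imset _ curve_point_inj) cardX; congr (_ + _)%N.
suff -> : pinf \notin curve_point @: setX (~: U) setT by [].
apply/imsetP => -[zy _ pinfE]; have := pcoord_curve_point zy (ltn0Sn _).
by rewrite -pinfE pcoord_pinf //= => /eqP; rewrite eq_sym oner_eq0.
Qed.

(** [U] can be read off from the geometric points: the F_p-point with coordinates [z] and last
    coordinate 0 is on the curve exactly when [z] is outside [U]. *)
Lemma geom_points_eqns_inj (U V : {set {ffun 'I_h -> F}}) :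
  geom_points (eqns U) =1 geom_points (eqns V) -> U = V.
Proof.
pose c := to_Fpbar p.
have E (W : {set {ffun 'I_h -> F}}) z :
    geom_points (eqns W) (affine_point h (c \o point_vector z 0)) = (z \notin W).
  have v0 : (c \o point_vector z 0) 0 = 1 by rewrite /= rmorph1.
  apply/idP/idP => [geomP|nzW].
    have solP : solution W c (pcoord (affine_point h (c \o point_vector z 0))).
      exact/zero_locus_map_eqns.
    rewrite -(point_vectorK z 0); apply/solution_Fp => // r ltr.
    apply/eqP; rewrite -(fmorph_eq0 c) eqn_expr_morph -(solP r ltr); apply/eqP.
    by apply: eqn_expr_eq => // j ltj; rewrite pcoord_affine.
  have solz : solution W id (point_vector z 0) by apply/solution_Fp; rewrite ?point_vectorK.
  apply/(zero_locus_map_eqns W c) => r ltr.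
  transitivity (c (eqn_expr W id (point_vector z 0) r)); last by rewrite solz ?rmorph0.
  rewrite eqn_expr_morph; apply: eqn_expr_eq => // j ltj.
  by rewrite pcoord_affine.
by move=> eqUV; apply/setP => z; apply: negb_inj; rewrite -(E U z) eqUV E.
Qed.

Definition curve (U : {set {ffun 'I_h -> F}}) : smooth_curve p h.+1 :=
  @SmoothCurve p h.+1 (eqns U) (eqns_homogeneous U p_prime)
    (curve_irreducible U p_prime (to_Fpbar p))
    (curve_dimension U p_prime (to_Fpbar p))
    (curve_smooth p_prime (c := to_Fpbar p)).

Lemma card_ffun_Fp : #|{ffun 'I_h -> F}| = (p ^ h)%N.
Proof. by rewrite card_ffun !card_ord; congr (_ ^ _)%N; apply: Fp_cast. Qed.

Lemma double_le_card : (h.*2 <= #|{ffun 'I_h -> F}|)%N.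
Proof.
rewrite card_ffun_Fp; have p_gt1 := prime_gt1 p_prime.
have := ltn_expl h.-1 p_gt1; rewrite prednK // => lt.
by rewrite -mul2n -[X in (p ^ X)%N](prednK h_gt0) expnS leq_mul.
Qed.

(** The fixed set consists of the first [h.*2] points in the enumeration of F_p^h, and [c] is the
    rank of one of its subsets. *)
Definition subset_of_points (c : 'I_#|{set 'I_h.*2}|) : {set {ffun 'I_h -> F}} :=
  [set enum_val (widen_ord double_le_card i) | i in enum_val c].

Lemma card_subset_of_points c : #|subset_of_points c| = #|enum_val c|.
Proof.
apply: card_imset => i j /enum_val_inj/(congr1 val) /= ij; exact: val_inj.
Qed.

Lemma subset_of_points_inj c c' :
  geom_points (equations (curve (subset_of_points c))) =1
  geom_points (equations (curve (subset_of_points c'))) -> c = c'.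
Proof.
move=> /geom_points_eqns_inj/imset_inj E; apply/enum_val_inj/E => i j.
by move=> /enum_val_inj/(congr1 val) /= ij; exact: val_inj.
Qed.

Lemma card_sets_gt0 : (0 < #|{set 'I_h.*2}|)%N.
Proof. by apply/card_gt0P; exists set0. Qed.

Definition binomial_family : curve_family p :=
  @CurveFamily p h.+1 _ card_sets_gt0 (fun c => curve (subset_of_points c)) subset_of_points_inj.

Lemma num_points_binomial_family c : num_points (member binomial_family c) =
  (1 + p * (p ^ h - #|enum_val c : {set 'I_h.*2}|))%N.
Proof. by rewrite -card_subset_of_points -card_rational_points. Qed.

End RationalPoints.

End Geometry.

Import Geometry.
Import Order.TTheory GRing.Theory Num.Theory.
Local Open Scope ring_scope.

(** * Point counts of the families *)

Section BinomialSums.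
Variable R : comNzRingType.

(** The expectation of [f] under the symmetric binomial law, multiplied by 2^N. *)
Definition binomial_sum (N : nat) (f : nat -> R) : R :=
  \sum_(k < N.+1) 'C(N, k)%:R * f k.

Lemma binomial_sum_subsets (T : finType) (f : nat -> R) :
  \sum_(A : {set T}) f #|A| = binomial_sum #|T| f.
Proof.
have ltA (A : {set T}) : (#|A| < #|T|.+1)%N by rewrite ltnS max_card.
rewrite (partition_big (fun A => Ordinal (ltA A)) predT) //=; apply: eq_bigr => k _.
rewrite (eq_bigr (fun _ => f k)); last by move=> A /eqP <-.
rewrite sumr_const mulr_natl -card_draws; congr (_ *+ _).
by apply: eq_card => A; rewrite [RHS]inE.
Qed.

(** Pascal's rule, or conditioning on one of [N.+1] coin tosses; it gives the moments by induction
    on [N]. *)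
Lemma binomial_sumS N f :
  binomial_sum N.+1 f = binomial_sum N (fun k => f k + f k.+1).
Proof.
rewrite /binomial_sum big_ord_recl /=.
under eq_bigr => i _ do rewrite /bump leq0n add1n binS natrD mulrDl.
under [RHS]eq_bigr => i _ do rewrite mulrDr.
rewrite !big_split /= addrA; congr (_ + _).
rewrite [X in _ + X = _]big_ord_recr /= (bin_small (ltnSn N)) mul0r addr0.
by rewrite [RHS]big_ord_recl /= !bin0.
Qed.

Lemma eq_binomial_sum N f g : (forall k, (k <= N)%N -> f k = g k) ->
  binomial_sum N f = binomial_sum N g.
Proof. by move=> fg; apply: eq_bigr => k _; rewrite fg // -ltnS. Qed.

Lemma binomial_sumD N f g :
  binomial_sum N (fun k => f k + g k) = binomial_sum N f + binomial_sum N g.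
Proof. by rewrite -big_split; apply: eq_bigr => k _; rewrite mulrDr. Qed.

Lemma binomial_sumZ N a f : binomial_sum N (fun k => a * f k) = a * binomial_sum N f.
Proof. by rewrite mulr_sumr; apply: eq_bigr => k _; rewrite mulrCA. Qed.

Lemma binomial_sum_cst N a : binomial_sum N (fun=> a) = a * 2 ^+ N.
Proof.
elim: N => [|N IHN]; first by rewrite /binomial_sum big_ord1 bin0 mul1r expr0 mulr1.
by rewrite binomial_sumS binomial_sumD IHN exprS; ring.
Qed.

Lemma binomial_sum_centered N :
  binomial_sum N (fun k => N%:R - k%:R *+ 2) = 0.
Proof.
elim: N => [|N IHN]; first by rewrite /binomial_sum big_ord1 mul0rn subrr mulr0.
rewrite binomial_sumS (@eq_binomial_sum _ _ (fun k => 2 * (N%:R - k%:R *+ 2))).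
  by rewrite binomial_sumZ IHN mulr0.
by move=> k _; rewrite -!natr1; ring.
Qed.

Lemma binomial_sum_square N :
  binomial_sum N (fun k => (N%:R - k%:R *+ 2) ^+ 2) = N%:R * 2 ^+ N.
Proof.
elim: N => [|N IHN]; first by rewrite /binomial_sum big_ord1 mul0rn subrr expr0n mulr0 mul0r.
(* With t = N - 2k, one more toss leads to t + 1 or t - 1, and (t + 1)^2 + (t - 1)^2 = 2 t^2 + 2. *)
rewrite binomial_sumS (@eq_binomial_sum _ _ (fun k => 2 * (N%:R - k%:R *+ 2) ^+ 2 + 2)).
  by rewrite binomial_sumD binomial_sumZ IHN binomial_sum_cst -natr1 exprS; ring.
by move=> k _; rewrite -!natr1; ring.
Qed.

End BinomialSums.

Section FamilyStatistics.
Variables (R : rcfType) (p h : nat) (p_prime : prime p) (h_gt0 : (0 < h)%N).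
Local Notation F := (binomial_family p_prime h_gt0).
Local Notation cst := (1 + p%:R * (p%:R ^+ h - h%:R) : R).

Lemma sum_family (f : nat -> R) :
  \sum_(c < family_card F) f #|enum_val c : {set 'I_h.*2}| = binomial_sum h.*2 f.
Proof.
rewrite -[h.*2 in RHS]card_ord -binomial_sum_subsets.
by rewrite [RHS]big_enum_val.
Qed.

Lemma family_cardE : family_card F = (2 ^ h.*2)%N.
Proof. by rewrite /= -cardsT -powersetT card_powerset cardsT card_ord. Qed.

(** The count is its mean plus a multiple of the centred variable N - 2k with N = 2h, whose first
    two moments are known. *)
Lemma num_points_centered c : (num_points (member F c))%:R =
  cst + p%:R / 2 * ((h.*2)%:R - #|enum_val c : {set 'I_h.*2}|%:R *+ 2).
Proof.
rewrite num_points_binomial_family natrD natrM natrB ?natrX.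
  by move: #|_| => k; rewrite -muln2 natrM; field.
apply: leq_trans (max_card _) _; rewrite card_ord.
by have := double_le_card p_prime h_gt0; rewrite card_ffun_Fp.
Qed.

Lemma family_mean_binomial : family_mean R F = cst.
Proof.
rewrite /family_mean; under eq_bigr do rewrite num_points_centered.
rewrite (sum_family (fun k => cst + p%:R / 2 * ((h.*2)%:R - k%:R *+ 2))).
rewrite binomial_sumD binomial_sumZ binomial_sum_centered mulr0 addr0.
rewrite binomial_sum_cst family_cardE natrX mulrCA mulVf ?mulr1 //.
by rewrite expf_neq0 // pnatr_eq0.
Qed.

Lemma family_variance_binomial : family_variance R F = p%:R ^+ 2 * (h%:R / 2).
Proof.
rewrite /family_variance family_mean_binomial.
under eq_bigr do rewrite num_points_centered addrC addKr exprMn.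
rewrite (sum_family (fun k => (p%:R / 2) ^+ 2 * ((h.*2)%:R - k%:R *+ 2) ^+ 2)).
rewrite binomial_sumZ binomial_sum_square family_cardE natrX.
have : 2 ^+ h.*2 != 0 :> R by rewrite expf_neq0 // pnatr_eq0.
by move: (2 ^+ _) => M M_neq0; rewrite -muln2 natrM; field.
Qed.

Lemma normalized_count_binomial c : normalized_count R (F := F) c =
  (h%:R - #|enum_val c : {set 'I_h.*2}|%:R) / Num.sqrt (h%:R / 2).
Proof.
rewrite /normalized_count family_mean_binomial family_variance_binomial num_points_centered.
have p_gt0 : 0 < p%:R :> R by rewrite ltr0n prime_gt0.
have h2_gt0 : 0 < Num.sqrt (h%:R / 2) :> R by rewrite sqrtr_gt0 divr_gt0 ?ltr0n.
rewrite sqrtrM ?sqr_ge0 // sqrtr_sqr gtr0_norm // addrC addKr.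
move: #|_| => k; rewrite -muln2 natrM.
by field; rewrite !gt_eqF.
Qed.

Lemma proportion_binomial (I : pred R) : proportion_in F I =
  (2 ^+ h.*2)^-1 *
  binomial_sum h.*2 (fun k => (I ((h%:R - k%:R) / Num.sqrt (h%:R / 2)))%:R).
Proof.
rewrite /proportion_in; congr (_^-1 * _); first by rewrite family_cardE natrX.
rewrite -sum_family -sum1_card natr_sum big_mkcond /=; apply: eq_bigr => c _.
by rewrite inE normalized_count_binomial; case: (I _).
Qed.

End FamilyStatistics.

From mathcomp Require Import all_classical all_reals all_analysis.
From mathcomp Require Import measurable_realfun.
Import Order.TTheory GRing.Theory Num.Theory.
Import numFieldNormedType.Exports.
Local Open Scope classical_set_scope.
Local Open Scope ring_scope.

(** * The central limit theorem for binomial coefficients *)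

Section CentralBinomialRatio.
Variable R : realType.

Definition bratio (h k : nat) : R := 'C(h.*2, k)%:R / 'C(h.*2, h)%:R.

Lemma bin_double_gt0 h : 0 < 'C(h.*2, h)%:R :> R.
Proof. by rewrite ltr0n bin_gt0 -addnn leq_addr. Qed.

Lemma bratio_ge0 h k : 0 <= bratio h k.
Proof. by rewrite divr_ge0. Qed.

Lemma bratio_sym h m : (m <= h)%N -> bratio h (h - m) = bratio h (h + m).
Proof.
move=> lemh; rewrite /bratio -bin_sub; last by lia.
by congr ('C(_, _)%:R / _); lia.
Qed.

Lemma bratio_step h m : (m < h)%N ->
  bratio h (h + m.+1) = bratio h (h + m) * ((h%:R - m%:R) / (h%:R + m.+1%:R)).
Proof.
move=> ltmh; have hm_neq0 : h%:R + m.+1%:R != 0 :> R by rewrite -natrD pnatr_eq0 addnS.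
have := mul_bin_left h.*2 (h + m); rewrite (_ : h.*2 - (h + m) = h - m)%N; last by lia.
move/(congr1 (fun n => n%:R : R)); rewrite -addnS !natrM natrD natrB 1?ltnW // => E.
rewrite /bratio; have := bin_double_gt0 h; move: ('C(h.*2, h)%:R) => B B_gt0.
apply: (mulfI hm_neq0); rewrite mulrA E; move: (_ + m.+1%:R) hm_neq0 => d d_neq0.
by field; rewrite d_neq0 gt_eqF.
Qed.

Lemma bratio_mid h : bratio h (h + 0) = 1.
Proof. by rewrite addn0 /bratio divff // gt_eqF // bin_double_gt0. Qed.

(** The step ratio is 1 - (2m+1)/(h+m+1), at most exp(-(2m+1)/(h+M)), and the odd numbers 2m+1 add
    up to a square. The fixed [M] keeps the denominator constant along the induction. *)
Lemma bratio_upper h M m : (m <= M)%N -> (M <= h)%N ->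
  bratio h (h + m) <= expR (- (m%:R ^+ 2 / (h%:R + M%:R))).
Proof.
move=> + leMh; elim: m => [|m IHm] ltmM.
  by rewrite bratio_mid expr0n mul0r oppr0 expR0.
rewrite bratio_step; last exact: leq_trans leMh.
have hM_gt0 : 0 < h%:R + M%:R :> R by rewrite -natrD ltr0n; lia.
have hm_gt0 : 0 < h%:R + m.+1%:R :> R by rewrite -natrD ltr0n; lia.
have lehm : h%:R + m.+1%:R <= h%:R + M%:R :> R by rewrite lerD2l ler_nat.
have E : (h%:R - m%:R) / (h%:R + m.+1%:R) <= expR (- ((m%:R *+ 2 + 1) / (h%:R + M%:R))) :> R.
  apply: le_trans (expR_ge1Dx _); rewrite ler_pdivrMr // mulrDl mul1r mulNr.
  have : (m%:R *+ 2 + 1) / (h%:R + M%:R) * (h%:R + m.+1%:R) <= m%:R *+ 2 + 1 :> R.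
    by rewrite mulrAC ler_pdivrMr // ler_wpM2l // addr_ge0 // mulrn_wge0.
  by have : m%:R + 1 = m.+1%:R :> R := natr1 m; move: (_ * _) => d; lra.
apply: le_trans (ler_pM (bratio_ge0 _ _) _ (IHm (ltnW ltmM)) E) _.
  by apply: divr_ge0; [rewrite subr_ge0 ler_nat; lia | exact: ltW].
by rewrite -expRD ler_expR -opprD -mulrDl -natr1 (_ : _ + _ = (m%:R + 1) ^+ 2) //; ring.
Qed.

(** The same bound 1 + t <= exp(t), applied to the inverse of the step ratio, 1 + (2m+1)/(h-m). *)
Lemma bratio_lower h M m : (m <= M)%N -> (M < h)%N ->
  expR (- (m%:R ^+ 2 / (h%:R - M%:R))) <= bratio h (h + m).
Proof.
move=> + ltMh; elim: m => [|m IHm] ltmM.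
  by rewrite bratio_mid expr0n mul0r oppr0 expR0.
have ltmh : (m < h)%N by apply: leq_trans ltmM (ltnW ltMh).
rewrite bratio_step //.
have hM_gt0 : 0 < h%:R - M%:R :> R by rewrite subr_gt0 ltr_nat.
have hm_gt0 : 0 < h%:R - m%:R :> R by rewrite subr_gt0 ltr_nat.
have lehm : h%:R - M%:R <= h%:R - m%:R :> R by rewrite lerB // ler_nat ltnW.
have hm1_gt0 : 0 < h%:R + m.+1%:R :> R by rewrite -natrD ltr0n; lia.
have E : expR (- ((m%:R *+ 2 + 1) / (h%:R - M%:R))) <= (h%:R - m%:R) / (h%:R + m.+1%:R) :> R.
  rewrite expRN -[leRHS]invrK lef_pV2 ?posrE ?expR_gt0 ?invr_gt0 ?divr_gt0 //.
  apply: le_trans (expR_ge1Dx _); rewrite invf_div ler_pdivrMr // mulrDl mul1r.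
  rewrite -natr1 (_ : h%:R + (m%:R + 1) = (h%:R - m%:R) + (m%:R *+ 2 + 1)); last by ring.
  rewrite lerD2l mulrAC ler_pdivlMr // ler_wpM2l //.
apply: le_trans (ler_pM (expR_ge0 _) (expR_ge0 _) (IHm (ltnW ltmM)) E).
rewrite -expRD ler_expR -opprD -mulrDl -natr1.
by have -> : (m%:R + 1) ^+ 2 = m%:R ^+ 2 + (m%:R *+ 2 + 1) :> R by ring.
Qed.

End CentralBinomialRatio.

(** * Binomial sums as integrals of step functions *)

Section DeMoivreLaplace.
Variable R : realType.
Local Notation mu := (@lebesgue_measure R).

Definition dev (h : nat) : R := Num.sqrt (h%:R / 2).
Definition node (h k : nat) : R := (h%:R - k%:R) / dev h.
Definition cell (h k : nat) : set R := `[node h k, node h k + (dev h)^-1[.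

(** The cells are disjoint of length 1/[dev h], so the integral is the normalized sum of the weights
    with node in [A], and dominated convergence can be used. *)
Definition stepf (A : set R) (h : nat) (x : R) : R :=
  \sum_(k < h.*2.+1) (bratio R h k * \1_A (node h k)) * \1_(cell h k) x.

Lemma dev_gt0 h : (0 < h)%N -> 0 < dev h.
Proof. by move=> h_gt0; rewrite sqrtr_gt0 divr_gt0 ?ltr0n. Qed.

Lemma dev_sqr h : dev h ^+ 2 = h%:R / 2.
Proof. by rewrite sqr_sqrtr // divr_ge0. Qed.

Lemma cellP h k x : (0 < h)%N ->
  \1_(cell h k) x = (Num.floor (x * dev h) == h%:Z - k%:Z)%:R :> R.
Proof.
move=> h_gt0; have d_gt0 := dev_gt0 h_gt0.
rewrite indicE; congr (_%:R); congr nat_of_bool; rewrite mem_setE /cell in_itv /= floor_eq.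
rewrite /node -[X in _ < _ + X]mul1r -mulrDl ler_pdivrMr // ltr_pdivlMr //.
by rewrite (intrD R (h%:Z - k%:Z) 1) intrB.
Qed.

Lemma stepfE A h x : (0 < h)%N -> let j := Num.floor (x * dev h) in
  stepf A h x = if (absz j <= h)%N
    then bratio R h (h + absz j) * \1_A (j%:~R / dev h) else 0.
Proof.
move=> h_gt0 /=; rewrite /stepf; under eq_bigr do rewrite cellP //.
move: (Num.floor _) => j; case: ifP => [lej|/negbT ltj]; last first.
  apply: big1 => k _; have ltk := ltn_ord k; rewrite (_ : _ == _ = false) ?mulr0 //.
  by apply/eqP; lia.
pose k := absz (h%:Z - j); have ltk : (k < h.*2.+1)%N by rewrite /k; lia.
have jE : j = h%:Z - k%:Z by rewrite /k; lia.
rewrite (bigD1 (Ordinal ltk)) //= -jE eqxx mulr1 big1 ?addr0; last first.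
  move=> i; rewrite -val_eqE /= => i_neq; rewrite (_ : _ == _ = false) ?mulr0 //.
  by apply/eqP; lia.
have -> : bratio R h k = bratio R h (h + absz j).
  have [lekh|ltkh] := leqP k h.
    by rewrite -bratio_sym //; congr bratio; lia.
  by congr bratio; lia.
by congr (_ * \1_A _); rewrite /node jE intrB.
Qed.

Lemma stepf_ge0 A h x : 0 <= stepf A h x.
Proof. by apply: sumr_ge0 => k _; rewrite !mulr_ge0 ?bratio_ge0. Qed.

Lemma floor_node h x : (0 < h)%N -> let t := (Num.floor (x * dev h))%:~R / dev h in
  x - (dev h)^-1 < t <= x.
Proof.
move=> h_gt0 /=; have d_gt0 := dev_gt0 h_gt0.
have /andP[le_fl lt_fl] := floor_itv (x * dev h).
rewrite ltr_pdivlMr // ler_pdivrMr // le_fl andbT mulrBl mulVf ?gt_eqF //.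
by rewrite ltrBlDr; move: lt_fl; rewrite intrD.
Qed.

Lemma intr_absz (j : int) : (absz j)%:R = `|j%:~R| :> R.
Proof. by rewrite natr_absz intr_norm. Qed.

(** Taking [M = h] in [bratio_upper] gives exp(-t^2/4) at the node t of the cell of x. Since |x - t|
    is at most 1/[dev h], whose square is at most 2, x^2 <= 2 t^2 + 2 (x - t)^2 <= 2 t^2 + 4. *)
Lemma stepf_le A h x : (0 < h)%N -> stepf A h x <= expR (2^-1 - x ^+ 2 / 8).
Proof.
move=> h_gt0; rewrite stepfE //; case: ifP => lej; last exact: expR_ge0.
have d_gt0 := dev_gt0 h_gt0; set j := Num.floor _ in lej *; set t := j%:~R / dev h.
have /andP[lt_t le_t] := floor_node x h_gt0; rewrite -/j -/t in lt_t le_t.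
have := bratio_upper R lej (leqnn h); set m := absz j in lej *.
have mE : m%:R ^+ 2 = t ^+ 2 * (h%:R / 2) :> R.
  by rewrite intr_absz real_normK ?num_real // -dev_sqr -exprMn divfK ?gt_eqF.
have h_neq0 : h%:R != 0 :> R by rewrite pnatr_eq0 -lt0n.
have -> : m%:R ^+ 2 / (h%:R + h%:R) = t ^+ 2 / 4 :> R.
  by rewrite mE; field; rewrite -natrD pnatr_eq0 addnn double_eq0 -lt0n.
move=> le_b; apply: le_trans (_ : expR (- (t ^+ 2 / 4)) <= _); last first.
  rewrite ler_expR; have d2 : (dev h)^-1 ^+ 2 <= 2.
    rewrite exprVn dev_sqr invf_div ler_pdivrMr ?ltr0n // ler_peMr //.
    by rewrite ler1n.
  have : (x - t) ^+ 2 <= (dev h)^-1 ^+ 2.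
    have dV_ge0 : 0 <= (dev h)^-1 by rewrite invr_ge0 ltW.
    by clearbody t; rewrite ler_sqr ?nnegrE //; lra.
  have : 0 <= (x - 2 * t) ^+ 2 by apply: sqr_ge0.
  by clearbody t; nra.
rewrite -[leRHS]mulr1; apply: ler_pM => //; exact: bratio_ge0.
Qed.

Lemma cvg_dev_inv : (dev i.+1)^-1 @[i --> \oo] --> (0 : R).
Proof.
have -> : (fun i => (dev i.+1)^-1) = (fun i => Num.sqrt (2 * @harmonic R i)).
  apply/funext => i; rewrite /dev -sqrtrV ?divr_ge0 // invf_div.
  by [].
have cvg2h : (2 * @harmonic R i) @[i --> \oo] --> (0 : R).
  by rewrite -[X in _ --> X](mulr0 2); apply: cvgMr; exact: cvg_harmonic.
by have := continuous_cvg _ (@sqrt_continuous R 0) cvg2h; rewrite sqrtr0; apply.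
Qed.

Section Pointwise.
Variables (A : set R) (x e : R).
Hypotheses (e_gt0 : 0 < e)
  (left_constant : forall t, x - e < t <= x -> \1_A t = \1_A x :> R).

Let t_ (i : nat) : R := (Num.floor (x * dev i.+1))%:~R / dev i.+1.

Lemma cvg_floor_node : t_ i @[i --> \oo] --> x.
Proof.
apply: (@squeeze_cvgr _ _ _ _ (fun i => x - (dev i.+1)^-1) (fun=> x)).
- by apply: nearW => i; have /andP[/ltW -> ->] := floor_node x (ltn0Sn i).
- by rewrite -[X in _ --> X]subr0; apply: cvgB; [exact: cvg_cst | exact: cvg_dev_inv].
- exact: cvg_cst.
Qed.

(** The node t of the cell of x tends to x from the left, hence the one-sided condition on [A]. With
    u = |t|/[dev h] and [M = m = u * h / 2], the two bounds on [bratio] have exponents -t^2/(2 + u)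
    and -t^2/(2 - u), and u tends to 0. *)
Lemma cvg_stepf : stepf A i.+1 x @[i --> \oo] --> expR (- (x ^+ 2) / 2) * \1_A x.
Proof.
pose u_ i := `|t_ i| * (dev i.+1)^-1.
have cvgu : u_ i @[i --> \oo] --> (0 : R).
  rewrite -(mulr0 `|x|); apply: cvgM; last exact: cvg_dev_inv.
  exact: cvg_norm cvg_floor_node.
have cvgt2 : t_ i ^+ 2 @[i --> \oo] --> x ^+ 2.
  rewrite expr2; under eq_fun do rewrite expr2.
  by apply: cvgM; exact: cvg_floor_node.
have cvg_bound (s : R) :
    expR (- (t_ i ^+ 2 / (2 + s * u_ i))) @[i --> \oo] --> expR (- (x ^+ 2) / 2).
  suff : (- (t_ i ^+ 2 / (2 + s * u_ i))) @[i --> \oo] --> - (x ^+ 2) / 2.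
    exact: (continuous_cvg _ (@continuous_expR R _)).
  rewrite mulNr; apply: cvgN; apply: cvgM => //.
  apply: cvgV; first by rewrite pnatr_eq0.
  rewrite -[X in _ --> X]addr0 -(mulr0 s); apply: cvgD; first exact: cvg_cst.
  by apply: cvgMr.
apply: (@squeeze_cvgr _ _ _ _
  (fun i => expR (- (t_ i ^+ 2 / (2 + (-1) * u_ i))) * \1_A x)
  (fun i => expR (- (t_ i ^+ 2 / (2 + 1 * u_ i))) * \1_A x)); last first.
- by apply: cvgMl; exact: cvg_bound.
- by apply: cvgMl; exact: cvg_bound.
near=> i.
have h_gt0 := ltn0Sn i; have d_gt0 := dev_gt0 h_gt0.
have /andP[lt_t le_t] := floor_node x h_gt0; rewrite -/(t_ i) in lt_t le_t.
have lt_de : (dev i.+1)^-1 < e.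
  near: i; exact: (cvgr_lt _ cvg_dev_inv).
have lt_u1 : u_ i < 1 by near: i; exact: (cvgr_lt _ cvgu).
rewrite stepfE //; set j := Num.floor _; set m := absz j.
have mE : m%:R = u_ i * (i.+1%:R / 2) :> R.
  rewrite /u_ intr_absz -dev_sqr expr2 -mulrA mulKf ?gt_eqF //.
  by rewrite -[X in _ * X]gtr0_norm // -normrM divfK ?gt_eqF.
have iS_gt0 : 0 < i.+1%:R :> R by rewrite ltr0n.
have ltm : (m < i.+1)%N.
  by rewrite -(ltr_nat R) mE; nra.
have m2E : m%:R ^+ 2 = t_ i ^+ 2 * (i.+1%:R / 2) :> R.
  by rewrite intr_absz real_normK ?num_real // -dev_sqr -exprMn divfK ?gt_eqF.
rewrite ltnW // -/(t_ i) left_constant; last by lra.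
have i_ge0 : 0 <= i%:R :> R by [].
have u_ge0 : 0 <= u_ i by rewrite mulr_ge0 // invr_ge0 ltW.
apply/andP; split; apply: ler_wpM2r => //.
  apply: le_trans (bratio_lower R (leqnn m) ltm); rewrite ler_expR lerN2 m2E mE.
  rewrite le_eqVlt; apply/orP; left; apply/eqP; field.
  by apply/andP; split; rewrite gt_eqF //; nra.
apply: le_trans (bratio_upper R (leqnn m) (ltnW ltm)) _; rewrite ler_expR lerN2 m2E mE.
rewrite le_eqVlt; apply/orP; left; apply/eqP; field.
by apply/andP; split; rewrite gt_eqF //; nra.
Unshelve. all: by end_near.
Qed.

End Pointwise.

Definition bsum (A : set R) (h : nat) : R :=
  (dev h)^-1 * \sum_(k < h.*2.+1) bratio R h k * \1_A (node h k).

Lemma measurable_cell h k : measurable (cell h k).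
Proof. exact: measurable_itv. Qed.

Lemma measure_cell h k : (0 < h)%N -> mu (cell h k) = ((dev h)^-1)%:E.
Proof.
move=> h_gt0; rewrite /cell lebesgue_measure_itv /= lte_fin ltrDl invr_gt0 dev_gt0 //.
by rewrite -EFinB addrAC subrr add0r.
Qed.

Lemma measurable_stepf A h : measurable_fun [set: R] (stepf A h).
Proof.
apply: measurable_sum => k; apply: measurable_funM => //.
exact: measurable_indic (measurable_cell h k).
Qed.

Lemma integral_stepf A h : (0 < h)%N ->
  (\int[mu]_x (stepf A h x)%:E = (bsum A h)%:E)%E.
Proof.
move=> h_gt0; under eq_integral do rewrite /stepf -sumEFin.
rewrite ge0_integral_sum //; last 2 first.
- move=> k; apply/measurable_EFinP; apply: measurable_funM => //.
  exact: measurable_indic (measurable_cell h k).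
- by move=> k x _; rewrite lee_fin !mulr_ge0 ?bratio_ge0.
rewrite /bsum mulr_sumr -sumEFin; apply: eq_bigr => k _.
under eq_integral do rewrite EFinM.
rewrite ge0_integralZl_EFin //; last 2 first.
- by apply/measurable_EFinP; exact: measurable_indic (measurable_cell h k).
- by rewrite mulr_ge0 ?bratio_ge0.
rewrite integral_indic // ?setIT; last exact: measurable_cell.
rewrite [X in (_ * X)%E](_ : _ = ((dev h)^-1)%:E); last exact: measure_cell.
by rewrite -EFinM mulrC.
Qed.

Section DominatedConvergence.
Variables (A : set R) (a : R).
Hypotheses (mA : measurable A) (left_constant : forall x, x != a ->
  exists2 e : R, 0 < e & forall t, x - e < t <= x -> \1_A t = \1_A x :> R).

Lemma cvg_bsum : bsum A i.+1 @[i --> \oo] -->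
  \int[mu]_(x in A) expR (- (x ^+ 2) / 2).
Proof.
pose f x : \bar R := (expR (- (x ^+ 2) / 2) * \1_A x)%:E.
(* The bound of [stepf_le] is a multiple of the normal density of standard deviation 2, which is
   integrable. *)
pose g x : \bar R := ((expR 2^-1 / normal_peak 2)%:E * (normal_pdf 0 2 x)%:E)%E.
have mf : measurable_fun [set: R] f.
  apply/measurable_EFinP; apply: measurable_funM; last exact: measurable_indic.
  apply: (measurableT_comp (@measurable_expR R)).
  by apply: measurable_funM => //; apply: measurableT_comp => //; exact: measurable_funX.
have cvg_ae : {ae mu, forall x, [set: R] x -> (stepf A i.+1 x)%:E @[i --> \oo] --> f x}.
  apply: (@negligibleS _ _ _ mu [set a]); last first.
    by apply/negligibleP => //; exact: lebesgue_measure_set1.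
  move=> x; rewrite /= => ncvg; apply: contrapT => xa; apply: ncvg => _.
  have [|e e_gt0 eA] := left_constant (x := x); first by apply/eqP.
  apply/cvg_EFin; first by apply: nearW.
  exact: cvg_stepf e_gt0 eA.
have intg : mu.-integrable [set: R] g.
  by apply: integrableZl => //; exact: integrable_normal_pdf.
have dom : {ae mu, forall x, forall i, [set: R] x -> (`|(stepf A i.+1 x)%:E| <= g x)%E}.
  apply: aeW => x i _; rewrite /= ger0_norm ?stepf_ge0 // lee_fin normal_pdfE ?pnatr_eq0 //.
  rewrite mulrA divfK ?gt_eqF ?normal_peak_gt0 ?pnatr_eq0 // /normal_fun -expRD subr0.
  rewrite (_ : 2 ^+ 2 *+ 2 = 8); last by rewrite -mulr_natr -natrX -natrM.
  by rewrite mulNr; exact: stepf_le.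
have mF i : measurable_fun [set: R] (fun x => (stepf A i.+1 x)%:E).
  by apply/measurable_EFinP; exact: measurable_stepf.
have [intf _ cvg_int] := @dominated_convergence _ _ R mu [set: R] measurableT
  (fun i x => (stepf A i.+1 x)%:E) f g mF mf cvg_ae intg dom.
have intE : (\int[mu]_(x in A) expR (- (x ^+ 2) / 2))%:E = (\int[mu]_x f x)%E.
  rewrite /Rintegral integral_mkcond.
  have -> : ((fun x : R => (expR (- (x ^+ 2) / 2))%:E) \_ A) = f.
    apply/funext => x; rewrite /f patchE indicE; case: (x \in A); by rewrite ?mulr1 ?mulr0.
  by rewrite fineK //; exact: integrable_fin_num intf.
rewrite -intE in cvg_int; have := fine_cvg cvg_int.
rewrite (_ : fine \o _ = fun i => bsum A i.+1); first by apply.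
by apply/funext => i /=; rewrite integral_stepf.
Qed.


End DominatedConvergence.

(** Read off from the total mass 1 of the standard normal density. *)
Lemma gaussian_integral : \int[mu]_(x in [set: R]) expR (- (x ^+ 2) / 2) = Num.sqrt (2 * pi).
Proof.
rewrite /Rintegral -[RHS]/(fine (Num.sqrt (2 * pi))%:E); congr fine.
pose I := (\int[mu]_x (expR (- (x ^+ 2) / 2))%:E)%E.
have peak_gt0 : 0 < normal_peak 1 :> R by rewrite normal_peak_gt0 ?oner_neq0.
have pdfE x : normal_pdf 0 1 x = normal_peak 1 * expR (- (x ^+ 2) / 2) :> R.
  by rewrite normal_pdfE ?oner_neq0 // /normal_fun subr0 expr1n.
have peakI : ((normal_peak 1)%:E * I = 1)%E.
  rewrite -(@integral_normal_pdf R 0 1) -ge0_integralZl_EFin //.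
  - by apply: eq_integral => x _; rewrite pdfE EFinM.
  - apply/measurable_EFinP; apply: (measurableT_comp (@measurable_expR R)).
    by apply: measurable_funM => //; apply: measurableT_comp => //; exact: measurable_funX.
  - exact: ltW.
have IE : I = ((normal_peak 1)^-1%:E * ((normal_peak 1)%:E * I))%E.
  by rewrite muleA -EFinM mulVf ?mul1e // gt_eqF.
rewrite -/I IE peakI mule1 /normal_peak invrK expr1n mul1r.
by rewrite -[pi *+ 2]mulr_natl.
Qed.

Lemma bsum_setT h : (0 < h)%N ->
  bsum [set: R] h = (dev h)^-1 * (2 ^+ h.*2 / 'C(h.*2, h)%:R).
Proof.
move=> h_gt0; rewrite /bsum -[2 ^+ _]mul1r -binomial_sum_cst /binomial_sum mulr_suml.
by congr (_ * _); apply: eq_bigr => k _; rewrite indicT /= /bratio !mulr1.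
Qed.

(* Dividing by the total mass replaces Stirling's formula. *)
Lemma de_moivre_laplace (a b : R) : a <= b ->
  (2 ^+ i.+1.*2)^-1 * binomial_sum i.+1.*2 (fun k => (node i.+1 k \in `[a, b]%R)%:R)
    @[i --> \oo] -->
  (Num.sqrt (2 * pi))^-1 * \int[mu]_(x in `[a, b]) expR (- (x ^+ 2) / 2).
Proof.
move=> leab; pose A : set R := [set` `[a, b]%R].
have cvgA : bsum A i.+1 @[i --> \oo] --> \int[mu]_(x in A) expR (- (x ^+ 2) / 2).
  apply: (@cvg_bsum A a) => [|x x_neq]; first exact: measurable_itv.
  have indE t : \1_A t = (a <= t <= b)%R%:R :> R by rewrite indicE /A mem_setE in_itv.
  (* Just to the left of x, membership in [a, b] agrees with that of x unless x = a; the right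
     endpoint is no exception. *)
  have [ltxa|lt_ax|/eqP] := ltgtP x a; last by rewrite (negPf x_neq).
    by exists 1 => // t /andP[_ letx]; rewrite !indE; congr (nat_of_bool _)%:R; lra.
  have [lexb|ltbx] := leP x b.
    by exists (x - a); rewrite ?subr_gt0 // => t /andP[lt le]; rewrite !indE; congr (nat_of_bool _)%:R; lra.
  by exists (x - b); rewrite ?subr_gt0 // => t /andP[lt le]; rewrite !indE; congr (nat_of_bool _)%:R; lra.
have cvgT : bsum [set: R] i.+1 @[i --> \oo] --> Num.sqrt (2 * pi).
  rewrite -gaussian_integral; apply: (@cvg_bsum _ 0) => // x _.
  by exists 1 => // t _; rewrite !indicT.
have s_gt0 : 0 < Num.sqrt (2 * pi) :> R by rewrite sqrtr_gt0 mulr_gt0 // pi_gt0.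
have := cvgM (cvgV (lt0r_neq0 s_gt0) cvgT) cvgA.
rewrite (_ : (_ \* _) = (fun i => (2 ^+ i.+1.*2)^-1 *
   binomial_sum i.+1.*2 (fun k => (node i.+1 k \in `[a, b]%R)%:R))); first by apply.
apply/funext => i /=; rewrite bsum_setT //.
have B_gt0 := bin_double_gt0 R i.+1; have d_gt0 := dev_gt0 (ltn0Sn i).
have -> : bsum A i.+1 = (dev i.+1)^-1 *
   (binomial_sum i.+1.*2 (fun k => (node i.+1 k \in `[a, b]%R)%:R) / 'C(i.+1.*2, i.+1)%:R).
  rewrite /bsum /binomial_sum mulr_suml; congr (_ * _); apply: eq_bigr => k _.
  by rewrite indicE /A mem_setE /bratio mulrAC.
have P_neq0 : 2 ^+ i.+1.*2 != 0 :> R by rewrite expf_neq0 // pnatr_eq0.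
move: (binomial_sum _ _) ('C(_, _)%:R) (dev _) (2 ^+ _) B_gt0 d_gt0 P_neq0.
move=> S B d P B_gt0 d_gt0 P_neq0.
by field; rewrite P_neq0 !gt_eqF.
Qed.

End DeMoivreLaplace.

Theorem theorem1 (R : realType) (p : nat) (p_prime : prime p) :
  exists F : nat -> curve_family p,
    [/\ (family_card (F i))%:R @[i --> \oo] --> (+oo : set_system R),
        family_mean R (F i) @[i --> \oo] --> +oo,
        family_variance R (F i) @[i --> \oo] --> +oo &
        forall a b : R, a <= b ->
          proportion_in (F i) (fun x => x \in `[a, b]%R) @[i --> \oo] -->
            (Num.sqrt (2 * pi))^-1 *
            \int[lebesgue_measure]_(x in `[a, b]) expR (- (x ^+ 2) / 2)].
Proof.
exists (fun i => binomial_family p_prime (ltn0Sn i)).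
have p_gt1 : 2 <= p%:R :> R by rewrite ler_nat prime_gt1.
have to_infty (u : nat -> R) : (forall i, i%:R <= u i) -> u i @[i --> \oo] --> +oo.
  by move=> le_u; apply: (ger_cvgy _ cvgr_idn); apply: nearW.
have i_ge0 (i : nat) : 0 <= i%:R :> R by [].
split.
- apply: to_infty => i; rewrite family_cardE ler_nat.
  by apply: leq_trans (ltnW (ltn_expl i (ltnSn 1))) _; rewrite leq_exp2l //; lia.
- apply: to_infty => i; rewrite family_mean_binomial.
  (* With h = i + 1, the inequalities p^h >= 2h and p >= 2 make the mean 1 + p (p^h - h) larger than
     2h. *)
  have : (i.+1.*2)%:R <= p%:R ^+ i.+1 :> R.
    by rewrite -natrX ler_nat -(card_ffun_Fp _ p_prime) double_le_card.
  rewrite -muln2 natrM -natr1; move: (p%:R ^+ _) (i_ge0 i) => P i_ge leP.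
  have : 0 <= (p%:R - 2) * (P - (i%:R + 1)) :> R by apply: mulr_ge0; lra.
  by lra.
- apply: to_infty => i; rewrite family_variance_binomial -natr1.
  have p2_ge4 : 4 <= p%:R ^+ 2 :> R by rewrite expr2; nra.
  have := i_ge0 i => i_ge.
  have : 0 <= (p%:R ^+ 2 - 4) * (i%:R + 1) :> R by apply: mulr_ge0; lra.
  by lra.
move=> a b leab; have := @de_moivre_laplace R a b leab.
rewrite (_ : (fun i => (2 ^+ i.+1.*2)^-1 * _) = (fun i =>
  proportion_in (binomial_family p_prime (ltn0Sn i)) (fun x : R => x \in `[a, b]%R))) //.
by apply/funext => i; rewrite proportion_binomial.
Qed.
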